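(* Let $1\le p<\infty$ and $-\infty<a<b<\infty$, and consider the (real or complex) space $L_p(a,b)$. For every $n\in\mathbb{N}=\{1,2,\dots\}$, the $n$th derivative operator $$D^nf:=f^{(n)}$$ in $L_p(a,b)$ with maximal domain $$D(D^n):=W_p^n(a,b):=\bigl\{f\in L_p(a,b)\,\bigm|\, f(\cdot)\in C^{n-1}[a,b],\ f^{(n-1)}(\cdot)\in AC[a,b],\ f^{(n)}\in L_p(a,b)\bigr\}$$ is a chaotic operator.
   Context: $L_p(a,b)$ is the usual Banach space of equivalence classes (modulo Lebesgue-a.e. equality) of (real- or complex-valued) $p$-integrable functions on $(a,b)$ with norm $\|\cdot\|_p$. The notation $f$ designates an equivalence class and $f(\cdot)$ a representative of it; thus $f\in W_p^n(a,b)$ means that the class $f$ has a representative $f(\cdot)$ in $C^{n-1}[a,b]$ (the $n-1$ times continuously differentiable functions on $[a,b]$, with $C^0[a,b]=C[a,b]$) whose $(n-1)$st derivative is absolutely continuous on $[a,b]$ (i.e., belongs to $AC[a,b]$) and whose $n$th derivative, which exists a.e., represents an element $f^{(n)}$ of $L_p(a,b)$. Let $A$ be a (bounded or unbounded) linear operator in a (real or complex) Banach space $X$ with domain $D(A)\subseteq X$. Powers are taken with their natural domains, with $A^0:=I$ the identity operator, and $C^\infty(A):=\bigcap_{m=0}^\infty D(A^m)$. A nonzero vector $f\in C^\infty(A)$ is called hypercyclic for $A$ if its orbit $\{A^mf\}_{m=0}^\infty$ is dense in $X$; $A$ is called hypercyclic if it has a hypercyclic vector. A vector $f$ is called a periodic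 point of $A$ if there is an $N\in\mathbb{N}$ with $f\in D(A^N)$ and $A^Nf=f$. The operator $A$ is called chaotic if it is hypercyclic and the set $\operatorname{Per}(A)$ of its periodic points is dense in $X$. *)

(* Defs.v *)
From HB Require Import structures.
From mathcomp Require Import all_boot all_order all_algebra.
From mathcomp Require Import complex.
From mathcomp Require Import all_classical all_reals all_analysis.
From mathcomp Require Import measurable_realfun.
Set Implicit Arguments.
Unset Strict Implicit.
Unset Printing Implicit Defensive.

Import Order.TTheory GRing.Theory Num.Theory.
Import numFieldNormedType.Exports.
Local Open Scope classical_set_scope.
Local Open Scope ring_scope.

(* R or C, as an abstract field over R: these laws make z |-> re z + i (im z)
   an embedding of fields into C that is the identity on R. For C = R[i] the
   values of the norm `|z| are the elements of R[i] of the form x%:C. *)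
Record scalarField (R : realType) := ScalarField {
  scalar_sort :> numFieldType;
  of_real : {rmorphism R -> scalar_sort};
  re : scalar_sort -> R;
  im : scalar_sort -> R;
  re_of_real : forall x, re (of_real x) = x;
  im_of_real : forall x, im (of_real x) = 0;
  reD : forall z w, re (z + w) = re z + re w;
  imD : forall z w, im (z + w) = im z + im w;
  reM : forall z w, re (z * w) = re z * re w - im z * im w;
  imM : forall z w, im (z * w) = re z * im w + im z * re w;
  norm_scalar : forall z,
    `|z| = of_real (Num.sqrt (re z ^+ 2 + im z ^+ 2)) }.

Section instances.
Variable R : realType.

Program Definition real_scalars : scalarField R :=
  @ScalarField R R idfun id (fun=> 0) _ _ _ _ _ _ _.
Next Obligation. by []. Qed.
Next Obligation. by []. Qed.
Next Obligation. by []. Qed.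
Next Obligation. by move=> z w; rewrite addr0. Qed.
Next Obligation. by move=> z w /=; rewrite mulr0 subr0. Qed.
Next Obligation. by move=> z w /=; rewrite mulr0 mul0r addr0. Qed.
Next Obligation. by move=> z /=; rewrite expr0n addr0 sqrtr_sqr. Qed.

Program Definition complex_scalars : scalarField R :=
  @ScalarField R R[i] (real_complex R) (@complex.Re R) (@complex.Im R)
    _ _ _ _ _ _ _.
Next Obligation. by []. Qed.
Next Obligation. by []. Qed.
Next Obligation. by move=> [a b] [c d]. Qed.
Next Obligation. by move=> [a b] [c d]. Qed.
Next Obligation. by move=> [a b] [c d]. Qed.
Next Obligation. by move=> [a b] [c d]. Qed.
Next Obligation. by move=> z; rewrite complex.normc_def. Qed.

End instances.

Section scalar_theory.
Variables (R : realType) (K : scalarField R).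
Implicit Types (x y : R) (z w : K).
Local Notation ofR := (@of_real R K).

Definition modulus z : R := Num.sqrt (re z ^+ 2 + im z ^+ 2).

Lemma normE z : `|z| = ofR (modulus z). Proof. exact: norm_scalar. Qed.

Lemma of_real_inj : injective ofR. Proof. exact: fmorph_inj. Qed.

Lemma norm_of_real x : `|ofR x| = ofR `|x|.
Proof.
by rewrite normE /modulus re_of_real im_of_real expr0n addr0 sqrtr_sqr.
Qed.

Lemma of_real_ge0 x : (0 <= ofR x) = (0 <= x).
Proof.
apply/idP/idP => [|x0]; last by rewrite -(ger0_norm x0) -norm_of_real.
by move=> /ger0_norm; rewrite norm_of_real => /of_real_inj <-.
Qed.

Lemma of_real_le x y : (ofR x <= ofR y) = (x <= y).
Proof. by rewrite -subr_ge0 -rmorphB of_real_ge0 subr_ge0. Qed.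

Lemma of_real_lt x y : (ofR x < ofR y) = (x < y).
Proof. by rewrite !lt_neqAle of_real_le (inj_eq of_real_inj). Qed.

Lemma modulus_ge0 z : 0 <= modulus z. Proof. exact: sqrtr_ge0. Qed.

Lemma modulus0 : modulus (0 : K) = 0.
Proof. by apply: of_real_inj; rewrite -normE normr0 rmorph0. Qed.

Lemma modulus_eq0 z : (modulus z == 0) = (z == 0).
Proof. by rewrite -(inj_eq of_real_inj) rmorph0 -normE normr_eq0. Qed.

Lemma modulusM z w : modulus (z * w) = modulus z * modulus w.
Proof. by apply: of_real_inj; rewrite rmorphM -!normE normrM. Qed.

Lemma modulusD z w : modulus (z + w) <= modulus z + modulus w.
Proof. by rewrite -of_real_le rmorphD -!normE ler_normD. Qed.

Lemma modulusN z : modulus (- z) = modulus z.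
Proof. by apply: of_real_inj; rewrite -!normE normrN. Qed.

End scalar_theory.

Section Lp.
Context d (T : measurableType d) (R : realType).
Variables (mu : {measure set T -> \bar R}) (K : scalarField R).

Definition scalar_measurable (f : T -> K) :=
  measurable_fun setT (fun x => re (f x)) /\
  measurable_fun setT (fun x => im (f x)).

Lemma measurable_modulus f : scalar_measurable f ->
  measurable_fun setT (fun x => modulus (f x)).
Proof.
move=> [mr mi]; apply: measurableT_comp.
  by apply: continuous_measurable_fun; exact: sqrt_continuous.
by apply: measurable_funD; exact: measurable_funX.
Qed.

Lemma scalar_measurable_lin c f g : scalar_measurable f ->
  scalar_measurable g -> scalar_measurable (fun x => c * f x + g x).
Proof.
move=> [fr fi] [gr gi]; split.
  under eq_fun do rewrite reD reM; apply: measurable_funD => //.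
  by apply: measurable_funB; exact: measurable_funM.
under eq_fun do rewrite imD imM; apply: measurable_funD => //.
by apply: measurable_funD; exact: measurable_funM.
Qed.

Variables (p : R) (p1 : 1 <= p).

Definition Lp_norm (f : T -> K) : \bar R :=
  'N[mu]_p%:E[EFin \o (fun x => modulus (f x))].

Lemma Lp_normM c f : scalar_measurable f -> (Lp_norm f < +oo)%E ->
  Lp_norm (fun x => c * f x) = ((modulus c)%:E * Lp_norm f)%E.
Proof.
move=> mf ff; rewrite /Lp_norm.
have p1' : (1 <= p%:E)%E by rewrite lee_fin.
have fL : (fun x => modulus (f x)) \in Lfun mu p%:E.
  by apply/andP; rewrite !inE; split => //; exact: measurable_modulus.
rewrite -[modulus c in RHS]ger0_norm ?modulus_ge0//.
rewrite -(LnormZ (Lfun_Sub p1' fL)).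
by apply: eq_Lnorm => x /=; rewrite modulusM.
Qed.

Lemma Lp_normD f g : scalar_measurable f -> scalar_measurable g ->
  (Lp_norm (fun x => f x + g x)%R <= Lp_norm f + Lp_norm g)%E.
Proof.
move=> mf mg; have mfg : scalar_measurable (fun x => f x + g x).
  have := scalar_measurable_lin 1 mf mg.
  by under eq_fun do rewrite mul1r.
have p1' : (1 <= p%:E)%E by rewrite lee_fin.
apply: le_trans; last first.
  by apply: (eminkowski mu _ _ p1'); exact: measurable_modulus.
have p0 : 0 < p by exact: lt_le_trans p1.
rewrite /Lp_norm unlock; apply: gt0_ler_poweR.
- by rewrite invr_ge0 ltW.
- by rewrite in_itv/= leey integral_ge0// => *; exact: poweR_ge0.
- by rewrite in_itv/= leey integral_ge0// => *; exact: poweR_ge0.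
have mm (h : T -> R) : measurable_fun setT h ->
    measurable_fun setT (fun x => (`|(h x)%:E| `^ p)%E).
  move=> mh; apply: (measurableT_comp (measurable_poweR _)) => //.
  by apply: measurableT_comp => //; exact/measurable_EFinP.
apply: ge0_le_integral => //.
- by move=> *; exact: poweR_ge0.
- by apply: mm; exact: measurable_modulus.
- by apply: mm; apply: measurable_funD; exact: measurable_modulus.
move=> x _ /=; rewrite lee_fin ge0_ler_powR ?nnegrE ?(ltW p0)//.
by rewrite !ger0_norm ?addr_ge0 ?modulus_ge0// modulusD.
Qed.

(* [p1] does not occur in the predicate; it is an argument so that closure
   under linear combinations can be a canonical instance. *)
Definition Lp_pred of 1 <= p : {pred T -> K} :=
  mem [set f | scalar_measurable f /\ (Lp_norm f < +oo)%E].

Lemma Lp_submod_closed : submod_closed (Lp_pred p1).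
Proof.
have m0 : scalar_measurable (0 : T -> K).
  split; first by apply: eq_measurable_fun (measurable_cst (re (0 : K))).
  by apply: eq_measurable_fun (measurable_cst (im (0 : K))).
split.
  rewrite inE; split => //; rewrite /Lp_norm.
  rewrite (_ : EFin \o _ = cst 0%E) ?Lnorm0//.
    by rewrite eqe gt_eqF// (lt_le_trans _ p1).
  by apply/funext => x /=; rewrite modulus0.
move=> c f g; rewrite !inE => -[mf lf] [mg lg]; split.
  exact: scalar_measurable_lin.
apply: le_lt_trans (Lp_normD _ mg) _.
  have := scalar_measurable_lin c mf m0.
  by under eq_fun do rewrite addr0.
by rewrite lte_add_pinfty// Lp_normM// lte_mul_pinfty// lee_fin modulus_ge0.
Qed.

HB.instance Definition _ :=
  GRing.isSubmodClosed.Build K (T -> K) (Lp_pred p1) Lp_submod_closed.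

Definition Lp_fun := {f : T -> K | f \in Lp_pred p1}.
HB.instance Definition _ := SubChoice.on Lp_fun.
HB.instance Definition _ := [SubChoice_isSubLmodule of Lp_fun by <:].

Lemma Lp_funB (f g : Lp_fun) x : val (f - g) x = val f x - val g x.
Proof. by rewrite raddfB. Qed.

Definition ae_null : {pred Lp_fun} :=
  mem [set f : Lp_fun | \forall x \ae mu, val f x = 0].

Lemma ae_null_zmod_closed : zmod_closed ae_null.
Proof.
split; first by rewrite inE; apply/nearW => x; rewrite raddf0.
move=> f g; rewrite !inE => f0 g0.
by apply: filterS2 f0 g0 => x fx gx; rewrite Lp_funB fx gx subrr.
Qed.

HB.instance Definition _ :=
  GRing.isZmodClosed.Build Lp_fun ae_null ae_null_zmod_closed.

Definition Lp : Type := Quotient.quot ae_null.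
HB.instance Definition _ := GRing.Zmodule.on Lp.
HB.instance Definition _ := EqQuotient.on Lp.

Definition Lp_repr (f : Lp) : T -> K := val (repr f).

Local Open Scope quotient_scope.

Lemma Lp_pi_eq (f g : Lp_fun) :
  (\pi_Lp f = \pi_Lp g) <-> (\forall x \ae mu, val f x = val g x).
Proof.
split=> [/eqP|fg].
  rewrite -[_ == _]Quotient.idealrBE inE; apply: filterS => x.
  by rewrite Lp_funB => /eqP; rewrite subr_eq0 => /eqP.
apply/eqP; rewrite -[_ == _]Quotient.idealrBE inE; apply: filterS fg => x.
by rewrite Lp_funB => ->; rewrite subrr.
Qed.

Lemma Lp_pi_repr (f : Lp_fun) :
  \forall x \ae mu, Lp_repr (\pi_Lp f) x = val f x.
Proof. by apply/Lp_pi_eq; rewrite reprK. Qed.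

Lemma Lp_eq (f g : Lp) :
  (\forall x \ae mu, Lp_repr f x = Lp_repr g x) -> f = g.
Proof. by move/Lp_pi_eq; rewrite !reprK. Qed.

Definition Lp_scale (c : K) (f : Lp) : Lp := \pi_Lp (c *: repr f).

Lemma Lp_scaleE c f :
  \forall x \ae mu, Lp_repr (Lp_scale c f) x = c * Lp_repr f x.
Proof.
by apply: filterS (Lp_pi_repr (c *: repr f)) => x; rewrite linearZ.
Qed.

Lemma Lp_addE (f g : Lp) :
  \forall x \ae mu, Lp_repr (f + g) x = Lp_repr f x + Lp_repr g x.
Proof.
have -> : f + g = \pi_Lp (repr f + repr g).
  rewrite -[RHS]/(\pi_(Quotient.quot ae_null) _) raddfD.
  by congr (_ + _); rewrite [RHS]reprK.
by apply: filterS (Lp_pi_repr (repr f + repr g)) => x; rewrite raddfD.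
Qed.

Lemma Lp_scaleA a b (f : Lp) : Lp_scale a (Lp_scale b f) = Lp_scale (a * b) f.
Proof.
apply: Lp_eq; have := Lp_scaleE (a * b) f.
apply: filterS3 (Lp_scaleE b f) (Lp_scaleE a (Lp_scale b f)) => x.
by move=> bf -> ->; rewrite bf mulrA.
Qed.

Lemma Lp_scale1 : left_id 1 Lp_scale.
Proof.
by move=> f; apply: Lp_eq; apply: filterS (Lp_scaleE 1 f) => x; rewrite mul1r.
Qed.

Lemma Lp_scaleDr : right_distributive Lp_scale +%R.
Proof.
move=> c f g; apply: Lp_eq; near=> x.
have -> : Lp_repr (Lp_scale c (f + g)) x = c * Lp_repr (f + g) x.
  by near: x; exact: Lp_scaleE.
have -> : Lp_repr (f + g) x = Lp_repr f x + Lp_repr g x.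
  by near: x; exact: Lp_addE.
have -> : Lp_repr (Lp_scale c f + Lp_scale c g) x =
    Lp_repr (Lp_scale c f) x + Lp_repr (Lp_scale c g) x.
  by near: x; exact: Lp_addE.
have -> : Lp_repr (Lp_scale c f) x = c * Lp_repr f x.
  by near: x; exact: Lp_scaleE.
have -> : Lp_repr (Lp_scale c g) x = c * Lp_repr g x.
  by near: x; exact: Lp_scaleE.
exact: mulrDr.
Unshelve. all: by end_near. Qed.

Lemma Lp_scaleDl f : {morph Lp_scale^~ f : a b / a + b}.
Proof.
move=> a b; apply: Lp_eq; near=> x.
have -> : Lp_repr (Lp_scale (a + b) f) x = (a + b) * Lp_repr f x.
  by near: x; exact: Lp_scaleE.
have -> : Lp_repr (Lp_scale a f + Lp_scale b f) x =
    Lp_repr (Lp_scale a f) x + Lp_repr (Lp_scale b f) x.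
  by near: x; exact: Lp_addE.
have -> : Lp_repr (Lp_scale a f) x = a * Lp_repr f x.
  by near: x; exact: Lp_scaleE.
have -> : Lp_repr (Lp_scale b f) x = b * Lp_repr f x.
  by near: x; exact: Lp_scaleE.
exact: mulrDl.
Unshelve. all: by end_near. Qed.

HB.instance Definition _ := GRing.Zmodule_isLmodule.Build K Lp
  Lp_scaleA Lp_scale1 Lp_scaleDr Lp_scaleDl.

Lemma Lp_reprP (f : Lp) :
  scalar_measurable (Lp_repr f) /\ (Lp_norm (Lp_repr f) < +oo)%E.
Proof. by have := valP (repr f); rewrite inE. Qed.

Lemma eq_Lp_norm f g : scalar_measurable f -> scalar_measurable g ->
  (\forall x \ae mu, f x = g x) -> Lp_norm f = Lp_norm g.
Proof.
move=> mf mg fg; rewrite /Lp_norm unlock.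
suff -> : (\int[mu]_x `|(EFin \o (fun x => modulus (f x))) x| `^ p =
    \int[mu]_x `|(EFin \o (fun x => modulus (g x))) x| `^ p)%E by [].
have mm (h : T -> R) : measurable_fun setT h ->
    measurable_fun setT (fun x => (`|(h x)%:E| `^ p)%E).
  move=> mh; apply: (measurableT_comp (measurable_poweR _)) => //.
  by apply: measurableT_comp => //; exact/measurable_EFinP.
apply: ae_eq_integral => //.
- by apply: mm; exact: measurable_modulus.
- by apply: mm; exact: measurable_modulus.
by apply: filterS fg => x fgx _ /=; rewrite fgx.
Qed.

Definition Lp_normr (f : Lp) : K := of_real K (fine (Lp_norm (Lp_repr f))).

Lemma Lp_norm_fin_num (f : Lp) : Lp_norm (Lp_repr f) \is a fin_num.
Proof. by rewrite ge0_fin_numE ?Lnorm_ge0//; exact: (Lp_reprP f).2. Qed.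

Lemma Lp_ler_normD (f g : Lp) : Lp_normr (f + g) <= Lp_normr f + Lp_normr g.
Proof.
rewrite /Lp_normr -rmorphD of_real_le -lee_fin EFinD !fineK ?Lp_norm_fin_num//.
have [[mf _] [mg _]] := (Lp_reprP f, Lp_reprP g).
rewrite (eq_Lp_norm _ _ (Lp_addE f g)); last 2 first.
- exact: (Lp_reprP _).1.
- have := scalar_measurable_lin 1 mf mg.
  by under eq_fun do rewrite mul1r.
exact: Lp_normD.
Qed.

Lemma Lp_normrZ (c : K) (f : Lp) : Lp_normr (c *: f) = `|c| * Lp_normr f.
Proof.
have [mf lf] := Lp_reprP f.
rewrite normE /Lp_normr -rmorphM; congr (of_real K _).
apply: EFin_inj; rewrite EFinM !fineK ?Lp_norm_fin_num// -Lp_normM//.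
apply: eq_Lp_norm (Lp_scaleE c f); first exact: (Lp_reprP _).1.
have m0 : scalar_measurable (cst (0 : K)).
  split; first exact: (measurable_cst (re (0 : K))).
  exact: (measurable_cst (im (0 : K))).
have := scalar_measurable_lin c mf m0.
by under eq_fun do rewrite addr0.
Qed.

Lemma Lp_normr0_eq0 (f : Lp) : Lp_normr f = 0 -> f = 0.
Proof.
move=> nf0; have [mf lf] := Lp_reprP f.
have nf : Lp_norm (Lp_repr f) = 0%E.
  rewrite -[LHS]fineK ?Lp_norm_fin_num//; congr EFin.
  by apply: (@of_real_inj _ K); rewrite rmorph0.
have mmf : measurable_fun setT (EFin \o (fun x => modulus (Lp_repr f x))).
  by apply/measurable_EFinP; exact: measurable_modulus.
have p0 : (0 < p%:E)%E by rewrite lte_fin (lt_le_trans ltr01 p1).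
rewrite -[f]reprK.
have -> : 0 = \pi_Lp 0.
  by rewrite -[RHS]/(\pi_(Quotient.quot ae_null) _) raddf0.
apply/Lp_pi_eq; apply: filterS (Lnorm_eq0_eq0 mmf p0 nf) => x.
by move=> /(_ I) /= -[] /eqP; rewrite modulus_eq0 => /eqP.
Qed.

HB.instance Definition _ := Lmodule_isNormed.Build K Lp
  Lp_ler_normD Lp_normrZ Lp_normr0_eq0.

End Lp.

Section operators.
Variables (K : numFieldType) (X : normedModType K).

(* A possibly unbounded operator; the values of [op_fun] outside of [dom] are
   irrelevant. *)
Record linear_operator := LinearOperator {
  dom : set X;
  op_fun : X -> X;
  dom0 : dom 0;
  dom_linear : forall c f g, dom f -> dom g -> dom (c *: f + g);
  op_linear : forall c f g, dom f -> dom g ->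
    op_fun (c *: f + g) = c *: op_fun f + op_fun g }.

Variable A : linear_operator.

(* [power_dom m] is D(A^m), on which A^m is given by [iter m (op_fun A)] *)
Fixpoint power_dom (m : nat) : set X :=
  if m is k.+1 then [set f | power_dom k f /\ dom A (iter k (op_fun A) f)]
  else setT.

Definition Cinfty : set X := \bigcap_m power_dom m.

Definition orbit (f : X) : set X := range (fun m => iter m (op_fun A) f).

Definition hypercyclic_vector (f : X) :=
  [/\ f != 0, Cinfty f & dense (orbit f)].

Definition hypercyclic := exists f, hypercyclic_vector f.

Definition periodic_point (f : X) :=
  exists N, [/\ (0 < N)%N, power_dom N f & iter N (op_fun A) f = f].

Definition chaotic := hypercyclic /\ dense [set f | periodic_point f].

End operators.

Section derivative.
Variables (R : realType) (K : scalarField R) (a b : R).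
Implicit Types (f g : R -> K) (x : R).

(* One-sided at the endpoints of [a, b]. *)
Definition has_deriv f x (l : K) :=
  (of_real K (y - x))^-1 * (f y - f x) @[y --> within `[a, b] x^'] --> l.

Fixpoint has_nth_deriv_on (k : nat) f g : Prop :=
  if k is j.+1 then
    exists2 f1, {in `[a, b], forall x, has_deriv f x (f1 x)} &
                has_nth_deriv_on j f1 g
  else {in `[a, b], f =1 g}.

(* f belongs to C^k[a, b] and g is its derivative of order k *)
Definition Ck_deriv (k : nat) f g :=
  has_nth_deriv_on k f g /\ {within `[a, b], continuous g}.

Definition abs_continuous f :=
  forall e : R, 0 < e -> exists2 delta : R, 0 < delta &
  forall (m : nat) (u v : 'I_m -> R),
    (forall i, [/\ a <= u i, u i <= v i & v i <= b]) ->
    trivIset setT (fun i => `]u i, v i[%classic) ->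
    \sum_i (v i - u i) < delta ->
    \sum_i modulus (f (v i) - f (u i)) < e.

Lemma has_deriv_lin c f g x l m : has_deriv f x l -> has_deriv g x m ->
  has_deriv (fun y => c * f y + g y) x (c * l + m).
Proof.
move=> fl gm; rewrite /has_deriv.
under eq_fun => y.
  rewrite opprD addrACA mulrDr -mulrBr mulrCA.
  over.
apply: cvgD => //.
by apply: cvgM; first exact: cvg_cst.
Qed.

Lemma has_nth_deriv_on_lin k c f g f' g' : has_nth_deriv_on k f f' ->
  has_nth_deriv_on k g g' ->
  has_nth_deriv_on k (fun y => c * f y + g y) (fun y => c * f' y + g' y).
Proof.
elim: k f g => [|k ih] f g /=.
  by move=> ff' gg' x xab; rewrite ff'// gg'.
move=> [f1 ff1 f1f'] [g1 gg1 g1g'].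
exists (fun y => c * f1 y + g1 y); last exact: ih.
by move=> x xab; apply: has_deriv_lin; [exact: ff1|exact: gg1].
Qed.

Lemma Ck_deriv_lin k c f g f' g' : Ck_deriv k f f' -> Ck_deriv k g g' ->
  Ck_deriv k (fun y => c * f y + g y) (fun y => c * f' y + g' y).
Proof.
move=> [ff' cf'] [gg' cg']; split; first exact: has_nth_deriv_on_lin.
move=> x; apply: cvgD; last exact: cg'.
by apply: cvgM; [exact: cvg_cst|exact: cf'].
Qed.

Lemma abs_continuous_lin c f g : abs_continuous f -> abs_continuous g ->
  abs_continuous (fun y => c * f y + g y).
Proof.
move=> acf acg e e0.
have c0 : 0 < modulus c + 1 by rewrite ltr_wpDl ?modulus_ge0.
have [d1 d10 fd] := acf _ (divr_gt0 (divr_gt0 e0 c0) (ltr0Sn _ 1)).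
have [d2 d20 gd] := acg _ (divr_gt0 e0 (ltr0Sn _ 1)).
exists (Num.min d1 d2); first by rewrite lt_min d10 d20.
move=> m u v uv tuv; rewrite lt_min => /andP[l1 l2].
have := fd _ _ _ uv tuv l1; have := gd _ _ _ uv tuv l2.
set G := \sum_i _; set F := \sum_i _ => Ge Fe.
apply: (@le_lt_trans _ _ (modulus c * F + G)).
  rewrite mulr_sumr -big_split /=; apply: ler_sum => i _.
  rewrite -modulusM; apply: le_trans (modulusD _ _).
  by rewrite opprD addrACA mulrBr.
have F0 : 0 <= F by apply: sumr_ge0 => i _; exact: modulus_ge0.
have : (modulus c + 1) * F < e / 2.
  by rewrite mulrC -ltr_pdivlMr// mulrAC.
rewrite mulrDl mul1r => cF; rewrite [e]splitr ltr_leD// ?ltW//.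
by rewrite (le_lt_trans _ cF)// lerDl.
Qed.

Lemma has_deriv_interior f x l : x \in `]a, b[ -> has_deriv f x l ->
  (of_real K (y - x))^-1 * (f y - f x) @[y --> x^'] --> l.
Proof.
move=> xab fl U /fl; rewrite /= !nbhs_filterE => h.
have xab' : \forall y \near x^', y \in `]a, b[.
  by apply: nbhs_dnbhs; exact: near_in_itvoo.
have {}h : \forall y \near x^', `[a, b]%classic y ->
    U ((of_real K (y - x))^-1 * (f y - f x)) by exact: h.
rewrite -[_ x^' U]/(\forall y \near x^', U _).
apply: filterS2 h xab' => y + yab; apply.
by apply: subset_itv_oo_cc.
Qed.

Lemma has_deriv_unique f g x l m : {in `]a, b[, f =1 g} -> x \in `]a, b[ ->
  has_deriv f x l -> has_deriv g x m -> l = m.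
Proof.
move=> fg xab /(has_deriv_interior xab) fl /(has_deriv_interior xab) gm.
apply: (cvg_unique _ fl); first exact: norm_hausdorff.
apply: cvg_trans gm; apply: near_eq_cvg.
have : \forall y \near x^', y \in `]a, b[.
  by apply: nbhs_dnbhs; exact: near_in_itvoo.
by apply: filterS => y yab /=; rewrite !fg.
Qed.

Lemma has_nth_deriv_on_unique k f g f' g' : {in `]a, b[, f =1 g} ->
  has_nth_deriv_on k f f' -> has_nth_deriv_on k g g' ->
  {in `]a, b[, f' =1 g'}.
Proof.
have oc x : x \in `]a, b[ -> x \in `[a, b] by exact: subset_itv_oo_cc.
elim: k f g => [|k ih] f g fg /=.
  by move=> ff' gg' x xab; rewrite -ff' ?oc// -gg' ?oc// fg.
move=> [f1 ff1 f1f'] [g1 gg1 g1g']; apply: ih f1f' g1g' => x xab.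
exact: (has_deriv_unique fg xab (ff1 _ (oc _ xab)) (gg1 _ (oc _ xab))).
Qed.

Lemma has_deriv_continuous f x l : x \in `]a, b[ -> has_deriv f x l ->
  f y @[y --> x] --> f x.
Proof.
move=> xab /(has_deriv_interior xab) fl; apply/continuous_withinNx.
have ofR0 : of_real K (y - x) @[y --> x^'] --> (0 : K).
  apply/cvgrPdist_lt => e e0; have me0 : 0 < modulus e.
    by rewrite lt_neqAle modulus_ge0 eq_sym modulus_eq0 gt_eqF.
  near=> y; rewrite sub0r normrN norm_of_real -(gtr0_norm e0) normE of_real_lt.
  near: y; apply: nbhs_dnbhs; near=> y; rewrite distrC.
  by near: y; exact: nbhsx_ballx.
have : (of_real K (y - x) * ((of_real K (y - x))^-1 * (f y - f x)) + f x)
    @[y --> x^'] --> 0 * l + f x.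
  by apply: cvgD; [exact: cvgM|exact: cvg_cst].
rewrite mul0r add0r; apply: cvg_trans; apply: near_eq_cvg.
have : \forall y \near x^', y != x by exact: nbhs_dnbhs_neq.
apply: filterS => y yx; rewrite mulrA divff ?mul1r ?subrK//.
by rewrite fmorph_eq0 subr_eq0.
Unshelve. all: by end_near. Qed.

End derivative.

Section derivative_operator.
Variables (R : realType) (K : scalarField R) (p : R) (p1 : 1 <= p).
Variables (a b : R).

(* With this measure, functions on R are identified as soon as they agree almost
   everywhere on ]a, b[. *)
Definition lebesgue_oo : {measure set (measurableTypeR R) -> \bar R} :=
  mrestr lebesgue_measure (measurable_itv `]a, b[).

Local Notation mu := lebesgue_oo.

Lemma ae_continuous_eq (f g : R -> K) x : x \in `]a, b[ ->
  f y @[y --> x] --> f x -> g y @[y --> x] --> g x ->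
  (\forall y \ae mu, f y = g y) -> f x = g x.
Proof.
move=> xab fx gx [N [mN N0 fgN]]; apply/eqP/negPn/negP => fgx.
have : \forall y \near x, `]a, b[%classic y /\ f y != g y.
  near=> y; split; first by near: y; exact: near_in_itvoo.
  rewrite -subr_eq0; near: y; apply: (cvgr_neq0 (f x - g x)).
    by apply: cvgB.
  by rewrite subr_eq0.
move=> /nbhs_ballP[e /= e0 xe].
have xeN : ball x e `<=` N `&` `]a, b[.
  move=> y /xe[yab /eqP fgy]; split => //; exact: fgN.
have : (lebesgue_measure (ball x e) <= lebesgue_measure (N `&` `]a, b[))%E.
  apply: le_measure => //; rewrite inE; first exact: measurable_ball.
  exact: measurableI.
have -> : lebesgue_measure (N `&` `]a, b[%classic) = 0%E by exact: N0.
by rewrite lebesgue_measure_ball ?(ltW e0)// lee_fin leNgt mulrn_wgt0.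
Unshelve. all: by end_near. Qed.

Definition Lp_interval : normedModType K := Lp lebesgue_oo K p1.

(* f is in W_p^n(a, b) and h is the class f^(n), for n > 0: g is the smooth
   representative of f and g' = g^(n-1). At points of ]a, b[, [has_deriv a b]
   is the usual two-sided derivative. *)
Definition has_Lp_deriv (n : nat) (f h : Lp_interval) :=
  exists g g' : R -> K,
    [/\ \forall x \ae mu, Lp_repr f x = g x,
        Ck_deriv a b n.-1 g g',
        abs_continuous a b g' &
        \forall x \ae mu, has_deriv a b g' x (Lp_repr h x)].

Definition sobolev (n : nat) : set Lp_interval :=
  [set f | exists h, has_Lp_deriv n f h].

(* The class h is unique, see [has_Lp_deriv_unique]. *)
Definition nth_deriv (n : nat) (f : Lp_interval) : Lp_interval :=
  xget 0 [set h | has_Lp_deriv n f h].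

Lemma ae_in_oo : \forall x \ae mu, x \in `]a, b[.
Proof.
exists (~` `]a, b[%classic); split; first exact: measurableC.
  by rewrite /= /lebesgue_oo /= /mrestr setICl measure0.
by move=> x /= xab.
Qed.

Lemma has_nth_deriv_on_continuous k (f f' : R -> K) x : Ck_deriv a b k f f' ->
  x \in `]a, b[ -> f y @[y --> x] --> f x.
Proof.
case: k => [|k] [] /=.
  move=> ff' cf' xab.
  have : {in `]a, b[%classic, continuous f'}.
    rewrite -continuous_open_subspace; last exact: interval_open.
    apply: (continuous_subspaceW _ cf') => y; exact: subset_itv_oo_cc.
  move=> /(_ x); rewrite inE => /(_ xab).
  rewrite /continuous_at -ff' ?subset_itv_oo_cc//.
  apply: cvg_trans; apply: near_eq_cvg.
  near=> y; apply/esym/ff'; apply: subset_itv_oo_cc.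
  by near: y; exact: near_in_itvoo.
move=> [f1 ff1 _] _ xab.
apply: (has_deriv_continuous xab); apply: ff1; exact: subset_itv_oo_cc.
Unshelve. all: by end_near. Qed.

Lemma has_Lp_deriv_unique n f h1 h2 :
  has_Lp_deriv n f h1 -> has_Lp_deriv n f h2 -> h1 = h2.
Proof.
move=> [g1 [g1' [fg1 c1 _ d1]]] [g2 [g2' [fg2 c2 _ d2]]].
have g12 : {in `]a, b[, g1 =1 g2}.
  move=> x xab; apply: (ae_continuous_eq xab).
  - exact: has_nth_deriv_on_continuous c1 xab.
  - exact: has_nth_deriv_on_continuous c2 xab.
  by apply: filterS2 fg1 fg2 => y -> .
have g12' := has_nth_deriv_on_unique g12 c1.1 c2.1.
apply: Lp_eq; near=> x.
have xab : x \in `]a, b[ by near: x; exact: ae_in_oo.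
apply: (has_deriv_unique g12' xab); first by near: x; exact: d1.
by near: x; exact: d2.
Unshelve. all: by end_near. Qed.

Lemma has_Lp_deriv_lin n c f g f' g' : has_Lp_deriv n f f' ->
  has_Lp_deriv n g g' -> has_Lp_deriv n (c *: f + g) (c *: f' + g').
Proof.
have linE (u v : Lp_interval) : \forall x \ae mu,
    Lp_repr (c *: u + v) x = c * Lp_repr u x + Lp_repr v x.
  apply: filterS2 (Lp_addE (c *: u) v) (Lp_scaleE c u) => x -> .
  by rewrite /GRing.scale /= => ->.
move=> [u [u' [fu cu au du]]] [v [v' [gv cv av dv]]].
exists (fun x => c * u x + v x), (fun x => c * u' x + v' x); split.
- by apply: filterS3 (linE f g) fu gv => x -> -> ->.
- exact: Ck_deriv_lin.
- exact: abs_continuous_lin.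
- by apply: filterS3 (linE f' g') du dv => x ->; exact: has_deriv_lin.
Qed.

Lemma has_Lp_deriv0 n : has_Lp_deriv n 0 0.
Proof.
have r0 : \forall x \ae mu, Lp_repr (0 : Lp_interval) x = 0.
  have := Lp_scaleE (0 : K) (0 : Lp_interval).
  rewrite -[Lp_scale _ _]/(0 *: (0 : Lp_interval)) scale0r.
  by apply: filterS => x ->; rewrite mul0r.
have d0 x : has_deriv a b (cst 0 : R -> K) x 0.
  rewrite /has_deriv; under eq_fun do rewrite subrr mulr0; exact: cvg_cst.
exists (cst 0), (cst 0); split => //.
- split; last by move=> x; exact: cvg_cst.
  by elim: n.-1 => //= k ih; exists (cst 0).
- move=> e e0; exists 1 => // m u v _ _ _.
  by rewrite big1// => i _; rewrite subrr modulus0.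
- by apply: filterS r0 => x ->.
Qed.

Lemma nth_derivP n f : sobolev n f -> has_Lp_deriv n f (nth_deriv n f).
Proof.
by move=> [h fh]; rewrite /nth_deriv; case: xgetP => [? ->//|/(_ h)].
Qed.

Program Definition nth_deriv_operator (n : nat) : linear_operator Lp_interval :=
  @LinearOperator K Lp_interval (sobolev n) (nth_deriv n) _ _ _.
Next Obligation. by move=> n; exists 0; exact: has_Lp_deriv0. Qed.
Next Obligation.
move=> n c f g [f' ff'] [g' gg']; exists (c *: f' + g').
exact: has_Lp_deriv_lin.
Qed.
Next Obligation.
move=> n c f g Wf Wg.
apply: has_Lp_deriv_unique (has_Lp_deriv_lin c (nth_derivP Wf) (nth_derivP Wg)).
apply: nth_derivP; exists (c *: nth_deriv n f + nth_deriv n g).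
exact: (has_Lp_deriv_lin c (nth_derivP Wf) (nth_derivP Wg)).
Qed.

End derivative_operator.

(* Main.v *)
Require Import Defs.
From mathcomp Require Import all_boot all_order all_algebra finmap.
From mathcomp Require Import all_classical all_reals all_analysis.
From mathcomp Require Import measurable_realfun ring lra zify.
Import Order.TTheory GRing.Theory Num.Theory.
Import numFieldNormedType.Exports HBSimple HBNNSimple.
Local Open Scope classical_set_scope.
Local Open Scope ring_scope.
Set Implicit Arguments.
Unset Strict Implicit.
Unset Printing Implicit Defensive.

(* In the coordinate sequence s of f = sum_j s_j (x - a)^j / j!, the operator
   D^n acts as the shift by n, and all such f with |s_j| <= M 2^j are smooth on
   [a, b], with a norm controlled by M and by the tail of the exponential series
   from the first nonzero s_j on. The f with finitely supported s are the
   polynomials; these are dense in Lp, since iterating q |-> 3 q^2 - 2 q^3 on an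
   affine q yields the indicators of half-lines. Making a finitely supported s
   periodic with a large period gives a nearby periodic point. A hypercyclic
   vector is obtained from a sequence which displays, in the blocks
   [n 2^k, n 2^(k+1)[, every finite word over Q infinitely often: shifting by
   n 2^k brings the word of block k to the front, while the later words start at
   position n 2^k with |s_j| <= 2j. *)

(** * Exponential power series *)

Section exponential_series.
Variable R : realType.
Implicit Types (s t : R^nat) (x y M L : R).

Definition expseries s x : R := limn (pseries (fun i => s i / i`!%:R) x).

Definition shift_seq n s : R^nat := fun i => s (i + n)%N.

(** Geometric growth makes [expseries s] converge everywhere and survives shifts up to a constant
    factor. Base 2 also covers the sequences with |s_j| <= j that are built below. *)
Definition exp_bounded M s := forall i, `|s i| <= M * 2 ^+ i.

Lemma shift_seq0 s : shift_seq 0 s = s.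
Proof. by apply/funext => i; rewrite /shift_seq addn0. Qed.

Lemma shift_seqD m n s : shift_seq m (shift_seq n s) = shift_seq (m + n) s.
Proof. by apply/funext => i; rewrite /shift_seq addnA. Qed.

Lemma exp_bounded_ge0 M s : exp_bounded M s -> 0 <= M.
Proof. by move/(_ 0%N); rewrite expr0 mulr1; exact: le_trans. Qed.

Lemma exp_boundedW M N s : M <= N -> exp_bounded M s -> exp_bounded N s.
Proof.
by move=> MN Ms i; rewrite (le_trans (Ms i))// ler_wpM2r// exprn_ge0.
Qed.

Lemma exp_bounded_shift M n s :
  exp_bounded M s -> exp_bounded (M * 2 ^+ n) (shift_seq n s).
Proof. by move=> Ms i; rewrite -mulrA -exprD addnC; exact: Ms. Qed.

Lemma exp_boundedB M N s t : exp_bounded M s -> exp_bounded N t ->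
  exp_bounded (M + N) (s \- t).
Proof.
by move=> Ms Nt i; rewrite mulrDl (le_trans (ler_normB _ _)) ?lerD.
Qed.

Lemma normed_expseries_le M s x i : exp_bounded M s ->
  `|s i / i`!%:R * x ^+ i| <= M * exp_coeff (2 * `|x|) i.
Proof.
move=> /(_ i) si; rewrite /exp_coeff /= !normrM normfV normrX normr_nat.
rewrite exprMn mulrAC mulrA ler_wpM2r ?invr_ge0// mulrA.
by rewrite ler_wpM2r ?exprn_ge0.
Qed.

Lemma is_cvg_expseries_norm M s x : exp_bounded M s ->
  cvgn [normed pseries (fun i => s i / i`!%:R) x].
Proof.
move=> Ms; apply: (@series_le_cvg _ _ (M *: exp_coeff (2 * `|x|))).
- by move=> i /=.
- move=> i; apply: mulr_ge0; first exact: exp_bounded_ge0 Ms.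
  by rewrite exp_coeff_ge0 ?mulr_ge0.
- by move=> i; exact: normed_expseries_le.
by apply: is_cvg_seriesZ; exact: is_cvg_series_exp_coeff.
Qed.

Lemma is_cvg_expseries M s x : exp_bounded M s ->
  cvgn (pseries (fun i => s i / i`!%:R) x).
Proof. by move=> Ms; apply: normed_cvg; exact: is_cvg_expseries_norm Ms. Qed.

(** Termwise differentiation turns x^i / i! into its predecessor, so the coordinates move one place
    down. *)
Lemma is_derive_expseries M s x : exp_bounded M s ->
  is_derive x 1 (expseries s) (expseries (shift_seq 1 s) x).
Proof.
have diffs t : pseries_diffs (fun i => t i / i`!%:R) =
    (fun i => shift_seq 1 t i / i`!%:R).
  apply/funext => i; rewrite /pseries_diffs /shift_seq addn1 factS natrM invfM.
  by rewrite mulrCA mulVKf.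
move=> Ms; rewrite /expseries -diffs.
have [M1 M2] := (exp_bounded_shift 1 Ms, exp_bounded_shift 2 Ms).
(* Any point farther from 0 than x would do: the series and its first two formal derivatives
   converge everywhere. *)
apply: (@pseries_snd_diffs _ _ (`|x| + 1)).
- exact: is_cvg_expseries Ms.
- by rewrite diffs; exact: is_cvg_expseries M1.
- by rewrite !diffs shift_seqD; exact: is_cvg_expseries M2.
- by rewrite [ltRHS]ger0_norm ?addr_ge0// ltrDl.
Qed.

Lemma continuous_expseries M s : exp_bounded M s -> continuous (expseries s).
Proof.
move=> Ms x; apply/differentiable_continuous/derivable1_diffP.
by have [] := is_derive_expseries x Ms.
Qed.

Lemma expseriesB M N s t x : exp_bounded M s -> exp_bounded N t ->
  expseries (s \- t) x = expseries s x - expseries t x.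
Proof.
move=> Ms Nt; apply/cvg_lim => //.
have -> : pseries (fun i => (s \- t) i / i`!%:R) x =
    pseries (fun i => s i / i`!%:R) x - pseries (fun i => t i / i`!%:R) x.
  apply/funext => k; rewrite /pseries /series /= fctE -sumrB.
  by apply: eq_bigr => i _; rewrite !mulrBl.
by apply: cvgB; [exact: is_cvg_expseries Ms|exact: is_cvg_expseries Nt].
Qed.

Definition exp_tail L J := expR L - series (exp_coeff L) J.

Lemma exp_tail_cvg0 L : exp_tail L J @[J --> \oo] --> (0 : R).
Proof.
rewrite /exp_tail -(subrr (expR L)); apply: cvgB; first exact: cvg_cst.
exact: is_cvg_series_exp_coeff.
Qed.

Lemma series_exp_coeff_le L J : 0 <= L -> series (exp_coeff L) J <= expR L.
Proof.
move=> L0; apply: (nondecreasing_cvgn_le _ (is_cvg_series_exp_coeff _) J).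
by apply: nondecreasing_series => i _ _; exact: exp_coeff_ge0.
Qed.

Lemma exp_tail_ge0 L J : 0 <= L -> 0 <= exp_tail L J.
Proof. by move=> L0; rewrite subr_ge0 series_exp_coeff_le. Qed.

(** The terms before J vanish, and the others are dominated by those of M exp(2 L). The case J = 0
    serves as a uniform bound on |x| <= L. *)
Lemma expseries_tail M s x L J : exp_bounded M s -> `|x| <= L ->
  (forall i, (i < J)%N -> s i = 0) ->
  `|expseries s x| <= M * exp_tail (2 * L) J.
Proof.
move=> Ms xL sJ; have M0 := exp_bounded_ge0 Ms.
have L0 : 0 <= L by exact: le_trans xL.
have /cvg_norm/(_ _) Scvg := @is_cvg_expseries M s x Ms.
rewrite -(cvg_lim _ Scvg)//; apply: limr_le; first exact: cvgP Scvg.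
near=> k; have Jk : (J <= k)%N by near: k; exact: nbhs_infty_ge.
rewrite /pseries /series /= (@big_cat_nat _ _ _ J)//= big_nat big1 ?add0r;
  last first.
  by move=> i /andP[_ iJ]; rewrite sJ// !mul0r.
rewrite (le_trans (ler_norm_sum _ _ _))//.
rewrite (@le_trans _ _ (\sum_(J <= i < k) M * exp_coeff (2 * L) i))//.
  apply: ler_sum => i _; apply: le_trans (normed_expseries_le x i Ms) _.
  rewrite ler_wpM2l// /exp_coeff /= ler_wpM2r ?invr_ge0//.
  rewrite lerXn2r ?nnegrE ?mulr_ge0//.
  by rewrite ler_wpM2l.
rewrite -mulr_sumr ler_wpM2l// /exp_tail lerBrDl.
rewrite {1}/series /= -big_cat_nat//=.
by rewrite series_exp_coeff_le// mulr_ge0.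
Unshelve. all: by end_near. Qed.

(** The coordinates of a polynomial are its derivatives at 0, whence the factor i!. *)
Lemma expseries_poly (q : {poly R}) x :
  expseries (fun i => q`_i * i`!%:R) x = q.[x].
Proof.
apply: lim_near_cst => //; exists (size q) => // k /= qk.
rewrite /pseries /series /= horner_coef.
rewrite -(big_mkord xpredT (fun i => q`_i * x ^+ i)).
rewrite (@big_cat_nat _ _ _ (size q)) //= [X in _ + X = _]big_nat.
rewrite [X in _ + X = _]big1 ?addr0.
  by apply: eq_bigr => i _; rewrite mulfK// pnatr_eq0 -lt0n fact_gt0.
by move=> i /andP[qi _]; rewrite nth_default// !mul0r.
Qed.

Definition eventually0 s := exists N, forall i, (N <= i)%N -> s i = 0.

Lemma eventually0_bounded s : eventually0 s -> exists M, exp_bounded M s.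
Proof.
move=> [N sN]; exists (\sum_(i < N) `|s i|) => i.
have [Ni|iN] := leqP N i.
  by rewrite sN// normr0 mulr_ge0 ?sumr_ge0.
rewrite (@le_trans _ _ (\sum_(i < N) `|s i|))//.
  by rewrite (bigD1 (Ordinal iN))//= lerDl sumr_ge0.
by rewrite ler_peMr ?sumr_ge0// exprn_ege1// ler1n.
Qed.

End exponential_series.

(** * Scalars and classes of real functions *)

Section scalar_coordinates.
Variables (R : realType) (K : scalarField R).
Implicit Types (z w : K).
Local Notation ofR := (@of_real R K).

Lemma modulus_gt0 z : 0 < z -> 0 < modulus z.
Proof.
by move=> z0; rewrite lt_neqAle modulus_ge0 eq_sym modulus_eq0 gt_eqF.
Qed.

Lemma re_additive : zmod_morphism (@re R K).
Proof.
have re0 : re (0 : K) = 0 by rewrite -(rmorph0 ofR) re_of_real.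
have reN z : re (- z) = - re z.
  by apply/eqP; rewrite -addr_eq0 -reD addNr re0.
by move=> z w; rewrite reD reN.
Qed.

Lemma im_additive : zmod_morphism (@im R K).
Proof.
have im0 : im (0 : K) = 0 by rewrite -(rmorph0 ofR) im_of_real.
have imN z : im (- z) = - im z.
  by apply/eqP; rewrite -addr_eq0 -imD addNr im0.
by move=> z w; rewrite imD imN.
Qed.

Lemma scalar_eq z w : re z = re w -> im z = im w -> z = w.
Proof.
move=> rzw izw; apply/eqP; rewrite -subr_eq0 -modulus_eq0 /modulus.
by rewrite re_additive im_additive rzw izw !subrr expr0n addr0 sqrtr0.
Qed.

Lemma re_le_modulus z : `|re z| <= modulus z.
Proof.
by rewrite -sqrtr_sqr ler_wsqrtr// lerDl sqr_ge0.
Qed.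

Lemma im_le_modulus z : `|im z| <= modulus z.
Proof.
by rewrite -sqrtr_sqr ler_wsqrtr// lerDr sqr_ge0.
Qed.

(* [iota] is 0 over the reals and may be taken to be 'i over the complex
   numbers. *)
Lemma scalar_coordinates :
  exists iota : K, forall z, z = iota * ofR (im z) + ofR (re z).
Proof.
have [[w w0]|noim] := pselect (exists w : K, im w != 0).
  (* Removing the real part of w and dividing by its imaginary part leaves an element with real part
     0 and imaginary part 1. *)
  exists ((w - ofR (re w)) / ofR (im w)) => z.
  have imwK : ofR (im w) != 0 by rewrite fmorph_eq0.
  pose d := (w - ofR (re w)).
  have rd : re d = 0 by rewrite re_additive re_of_real subrr.
  have id : im d = im w by rewrite im_additive im_of_real subr0.
  have E r : d / ofR (im w) * ofR r = d * ofR (r / im w).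
    by rewrite fmorph_div mulrAC mulrA.
  rewrite E; apply: scalar_eq.
    by rewrite reD reM rd im_of_real !re_of_real mul0r mulr0 subr0 add0r.
  rewrite imD imM rd id !im_of_real re_of_real mul0r add0r addr0.
  by rewrite mulrC divfK.
exists 0 => z; rewrite mul0r add0r.
apply: scalar_eq; rewrite ?re_of_real// im_of_real.
by apply/eqP/negPn/negP => iz; apply: noim; exists z.
Qed.

Lemma continuous_of_real : continuous (ofR : R -> K).
Proof.
move=> x; apply/cvgrPdist_lt => e e0.
have me0 := modulus_gt0 e0.
near=> y; rewrite -rmorphB norm_of_real -(gtr0_norm e0) normE of_real_lt.
by near: y; apply: cvgr_dist_lt.
Unshelve. all: by end_near. Qed.

End scalar_coordinates.

(** * Closure and density in normed spaces *)

Section closure_normed.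
Variables (K : numFieldType) (V : normedModType K).
Implicit Types (A : set V) (f g : V).

Lemma closure_normP A f :
  closure A f <-> forall e : K, 0 < e -> exists2 g, A g & `|f - g| < e.
Proof.
split=> [Af e e0|h B /nbhs_ballP[e /= e0 eB]].
  by have [g [Ag]] := Af _ (nbhsx_ballx f e e0); rewrite -ball_normE; exists g.
have [g Ag fg] := h _ e0; exists g; split => //.
by apply: eB; rewrite -ball_normE.
Qed.

Lemma dense_closure A : (forall f, closure A f) -> dense A.
Proof.
move=> clA O [f Of] oO.
by have [g [Ag Og]] := clA f O (open_nbhs_nbhs (conj oO Of)); exists g.
Qed.

Lemma dense_closureT A f : dense A -> closure A f.
Proof.
move=> dA; rewrite closureEonbhs => B O Ag [oO Of].
have [g [Og Aag]] := dA O (ex_intro _ f Of) oO.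
by exists g; split => //; exact: Ag.
Qed.

Lemma closure_scaleD A B c f g : closure A f -> closure B g ->
  closure [set c *: u + v | u in A & v in B] (c *: f + g).
Proof.
move=> /closure_normP Af /closure_normP Ag; apply/closure_normP => e e0.
(* Adding 1 keeps the divisor positive when c = 0. *)
have c0 : 0 < `|c| + 1 by rewrite ltr_wpDl.
have [u Au fu] := Af _ (divr_gt0 (divr_gt0 e0 c0) (ltr0Sn _ 1)).
have [v Av gv] := Ag _ (divr_gt0 e0 (ltr0Sn _ 1)).
exists (c *: u + v); first by exists u => //; exists v.
rewrite opprD addrACA -scalerBr (le_lt_trans (ler_normD _ _))// normrZ.
rewrite [ltRHS]splitr ler_ltD//.
apply: (@le_trans _ _ ((`|c| + 1) * `|f - u|)).
  by rewrite mulrDl mul1r lerDl.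
by rewrite mulrC -ler_pdivlMr// mulrAC ltW.
Qed.

Lemma closure_linear A c f g :
  (forall u v, A u -> A v -> A (c *: u + v)) ->
  closure A f -> closure A g -> closure A (c *: f + g).
Proof.
move=> lA Af Ag; apply: closureS (closure_scaleD Af Ag).
by move=> _ [u Au [v Av <-]]; exact: lA.
Qed.

Lemma closure_trans A B : A `<=` closure B -> closure A `<=` closure B.
Proof.
move=> AB; rewrite [in X in _ `<=` X](closure_id (closure B)).1;
  last exact: closed_closure.
exact: closureS.
Qed.

Lemma closure_cvgn A (f_ : nat -> V) f : (forall k, closure A (f_ k)) ->
  f_ k @[k --> \oo] --> f -> closure A f.
Proof.
by move=> Af; apply: closed_cvg; [exact: closed_closure|exact: nearW].
Qed.

End closure_normed.

(** * Real functions in Lp over the scalar field *)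

Section real_classes.
Context d (T : measurableType d) (R : realType).
Variables (mu : {measure set T -> \bar R}) (K : scalarField R).
Variables (p : R) (p1 : 1 <= p).
Implicit Types (u v g : T -> R) (f : T -> K).

Local Notation LK := (Lp mu K p1).
Local Notation ofR := (@of_real R K).
Local Open Scope quotient_scope.

Let p0 : 0 < p. Proof. exact: lt_le_trans ltr01 p1. Qed.
Let p1' : (1 <= p%:E)%E. Proof. by rewrite lee_fin. Qed.

(* The class of f, or 0 if f is not p-integrable. *)
Definition Lp_of f : LK := \pi_LK (insubd (0 : Lp_fun mu K p1) f).

Lemma Lp_ofE f : f \in Lp_pred mu p1 ->
  \forall x \ae mu, Lp_repr (Lp_of f) x = f x.
Proof.
move=> fL; apply: filterS (Lp_pi_repr (insubd (0 : Lp_fun mu K p1) f)) => x.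
by rewrite val_insubd fL.
Qed.

Lemma norm_Lp_of f : f \in Lp_pred mu p1 ->
  `|Lp_of f| = ofR (fine (Lp_norm mu p f)).
Proof.
move=> fL; rewrite -[LHS]/(Lp_normr _) /Lp_normr; congr (ofR (fine _)).
apply: eq_Lp_norm (Lp_ofE fL); first exact: (Lp_reprP _).1.
by move: fL; rewrite inE => -[].
Qed.

(** Through this embedding, the real theory of integration serves both scalar fields. *)
Definition Lp_real u : LK := Lp_of (ofR \o u).

Lemma Lp_norm_real u : Lp_norm mu p (ofR \o u) = 'N[mu]_p%:E[EFin \o u]%E.
Proof.
rewrite /Lp_norm -[RHS]Lnorm_abse; apply: eq_Lnorm => x /=.
by rewrite /modulus re_of_real im_of_real expr0n addr0 sqrtr_sqr.
Qed.

Lemma of_real_Lp_pred u : u \in Lfun mu p%:E -> ofR \o u \in Lp_pred mu p1.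
Proof.
move=> /andP[]; rewrite !inE => mu_u uoo; split; last by rewrite Lp_norm_real.
split; first by under eq_fun do rewrite /= re_of_real.
by under eq_fun do rewrite /= im_of_real; exact: measurable_cst.
Qed.

Lemma Lp_realE u : u \in Lfun mu p%:E ->
  \forall x \ae mu, Lp_repr (Lp_real u) x = ofR (u x).
Proof. by move=> /of_real_Lp_pred /Lp_ofE. Qed.

Lemma norm_Lp_real u : u \in Lfun mu p%:E ->
  `|Lp_real u| = ofR (fine 'N[mu]_p%:E[EFin \o u]%E).
Proof. by move=> /of_real_Lp_pred /norm_Lp_of ->; rewrite Lp_norm_real. Qed.

Lemma Lp_linE (c : K) (F G : LK) : \forall x \ae mu,
  Lp_repr (c *: F + G) x = c * Lp_repr F x + Lp_repr G x.
Proof.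
apply: filterS2 (Lp_addE (c *: F) G) (Lp_scaleE c F) => x -> .
by rewrite /GRing.scale /= => ->.
Qed.

Lemma Lp_real_lin r u v : u \in Lfun mu p%:E -> v \in Lfun mu p%:E ->
  Lp_real (r *: u + v) = ofR r *: Lp_real u + Lp_real v.
Proof.
move=> uL vL; apply: Lp_eq.
have uvL : r *: u + v \in Lfun mu p%:E.
  by rewrite (rpredD (rpredZ _ _))//; exact: p1'.
apply: filterS3 (Lp_linE (ofR r) (Lp_real u) (Lp_real v)) (Lp_realE uvL) _.
  move=> x -> ->; exact: id.
apply: filterS2 (Lp_realE uL) (Lp_realE vL) => x -> ->.
by rewrite rmorphD rmorphM.
Qed.

Lemma Lp_real0 : Lp_real 0 = 0.
Proof.
have L0 : 0 \in Lfun mu p%:E by rewrite rpred0//; exact: p1'.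
by have := Lp_real_lin (-1) L0 L0; rewrite rmorphN rmorph1 !scaleN1r !addNr.
Qed.

Lemma Lp_realZ r u : u \in Lfun mu p%:E ->
  Lp_real (r *: u) = ofR r *: Lp_real u.
Proof.
have L0 : 0 \in Lfun mu p%:E by rewrite rpred0//; exact: p1'.
by move=> uL; have := Lp_real_lin r uL L0; rewrite Lp_real0 !addr0.
Qed.

Lemma le_Lnorm_ae u g : measurable_fun setT u -> measurable_fun setT g ->
  (\forall x \ae mu, `|u x| <= g x) ->
  ('N[mu]_p%:E[EFin \o u] <= 'N[mu]_p%:E[EFin \o g])%E.
Proof.
move=> mu_u mg ug.
have mm (h : T -> R) : measurable_fun setT h ->
    measurable_fun setT (fun x => (`|(h x)%:E| `^ p)%E).
  move=> mh; apply: (measurableT_comp (measurable_poweR _)) => //.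
  by apply: measurableT_comp => //; exact/measurable_EFinP.
rewrite unlock; apply: gt0_ler_poweR.
- by rewrite invr_ge0 ltW.
- by rewrite in_itv/= leey integral_ge0// => *; exact: poweR_ge0.
- by rewrite in_itv/= leey integral_ge0// => *; exact: poweR_ge0.
apply: ae_ge0_le_integral => //.
- by move=> *; exact: poweR_ge0.
- exact: mm.
- by move=> *; exact: poweR_ge0.
- exact: mm.
apply: filterS ug => x ugx _ /=;
  rewrite lee_fin ge0_ler_powR ?nnegrE ?(ltW p0)//.
exact: le_trans ugx (ler_norm _).
Qed.

Lemma Lfun_dominated u g : measurable_fun setT u -> g \in Lfun mu p%:E ->
  (\forall x \ae mu, `|u x| <= g x) -> u \in Lfun mu p%:E.
Proof.
move=> mu_u /andP[/[!inE] /= mg goo] ug; apply/andP; rewrite !inE; split => //=.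
exact: le_lt_trans (le_Lnorm_ae mu_u mg ug) goo.
Qed.

Lemma le_norm_Lp_real u g : u \in Lfun mu p%:E -> g \in Lfun mu p%:E ->
  (\forall x \ae mu, `|u x| <= g x) -> `|Lp_real u| <= `|Lp_real g|.
Proof.
move=> uL gL ug; rewrite !norm_Lp_real// of_real_le fine_le//.
- by move: uL => /andP[_]; rewrite inE ge0_fin_numE ?Lnorm_ge0.
- by move: gL => /andP[_]; rewrite inE ge0_fin_numE ?Lnorm_ge0.
by move: uL gL => /andP[/[!inE] ? _] /andP[/[!inE] ? _]; exact: le_Lnorm_ae.
Qed.

(** The powers |u_k - u|^p tend to 0 almost everywhere and stay below (2 g)^p, so by dominated
    convergence their integrals, the p-th powers of the norms, tend to 0. *)
Lemma Lp_real_dominated (u_ : nat -> T -> R) u g :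
  (forall k, measurable_fun setT (u_ k)) -> measurable_fun setT u ->
  g \in Lfun mu p%:E ->
  (forall k, \forall x \ae mu, `|u_ k x| <= g x) ->
  (\forall x \ae mu, u_ k x @[k --> \oo] --> u x) ->
  Lp_real (u_ k) @[k --> \oo] --> Lp_real u.
Proof.
move=> mu_ mu_u gL ug uu.
(* Countably many null sets are merged into one. *)
have all_ug : \forall x \ae mu, forall k, `|u_ k x| <= g x.
  exact: ae_foralln.
have ugx : \forall x \ae mu, `|u x| <= g x.
  apply: filterS2 all_ug uu => x ukg uku.
  rewrite -(cvg_lim _ (cvg_norm uku))//.
  apply: limr_le; first exact: cvgP (cvg_norm uku).
  exact: nearW.
have uL k : u_ k \in Lfun mu p%:E by exact: Lfun_dominated gL (ug k).
have uLim : u \in Lfun mu p%:E by exact: Lfun_dominated gL ugx.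
have mpow (h : T -> R) : measurable_fun setT h ->
    measurable_fun setT (fun x => `|h x| `^ p).
  by move=> mh; apply: (@measurableT_comp _ _ _ _ _ _ (@powR R ^~ p)) => //;
    exact: measurableT_comp.
have /andP[/[!inE] /= mg goo] := gL.
pose D k x := (`|u_ k x - u x| `^ p)%:E.
have D0 : (\int[mu]_x D k x)%E @[k --> \oo] --> 0%E.
  have [|||||_ _] :=
    @dominated_convergence _ _ _ mu setT measurableT D (cst 0%E)
     (fun x => (2 `^ p * `|g x| `^ p)%:E).
  - by move=> k; apply/measurable_EFinP; apply: mpow; exact: measurable_funB.
  - exact: measurable_cst.
  - apply: filterS uu => x ux _; apply: cvg_EFin; first exact: nearW.
    rewrite /D /comp /=; apply/cvgrPdist_lt => e e0.
    have ep : 0 < e `^ p^-1 by exact: powR_gt0.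
    move/cvgrPdist_lt: ux => /(_ _ ep); apply: filterS => k.
    rewrite distrC sub0r normrN => ue; rewrite ger0_norm ?powR_ge0//.
    have -> : e = (e `^ p^-1) `^ p by rewrite -powRrM mulVf ?gt_eqF// powRr1//
      ltW.
    by apply: gt0_ltr_powR; rewrite ?nnegrE ?powR_ge0.
  - under eq_fun do rewrite EFinM; apply: integrableZl => //.
    apply/integrableP; split; first by apply/measurable_EFinP; exact: mpow.
    have := poweR_lty p goo; rewrite poweR_Lnorm ?gt_eqF//; apply: le_lt_trans.
    rewrite le_eqVlt; apply/orP; left; apply/eqP/eq_integral => x _ /=.
    by rewrite ger0_norm ?powR_ge0.
  - apply: filterS2 all_ug ugx => x ugk ugl k _ /=.
    rewrite lee_fin ger0_norm ?powR_ge0// -powRM//.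
    apply: ge0_ler_powR; rewrite ?nnegrE ?mulr_ge0// ?(ltW p0)//.
    rewrite (le_trans (ler_normB _ _))// mulr2n mulrDl mul1r lerD//.
      exact: le_trans (ugk k) (ler_norm _).
    exact: le_trans ugl (ler_norm _).
  by rewrite /= integral0; exact.
apply/cvgrPdist_lt => e e0.
have me0 := modulus_gt0 e0.
have : (\forall k \near \oo, \int[mu]_x D k x < (modulus e `^ p)%:E)%E.
  apply: (D0 (fun y => (y < (modulus e `^ p)%:E)%E)).
  by apply: open_ereal_lt'; rewrite lte_fin powR_gt0.
apply: filterS => k Dk.
have -> : Lp_real u - Lp_real (u_ k) = - (Lp_real (u_ k - u)).
  have -> : u_ k - u = -1 *: u + u_ k by rewrite scaleN1r addrC.
  by rewrite Lp_real_lin// rmorphN rmorph1 scaleN1r opprD opprK.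
have uukL : u_ k - u \in Lfun mu p%:E by rewrite rpredB//; exact: p1'.
rewrite normrN norm_Lp_real// -(gtr0_norm e0) normE of_real_lt -lte_fin fineK;
  last first.
  by move: uukL => /andP[_]; rewrite inE ge0_fin_numE ?Lnorm_ge0.
(* A norm of at least [modulus e] would, after raising to the power p, contradict the bound [Dk] on
   the integral. *)
rewrite ltNge; apply/negP => eN; move: Dk; rewrite ltNge => /negP; apply.
rewrite -poweR_EFin.
apply: le_trans (gt0_ler_poweR (ltW p0) _ _ eN) _.
- by rewrite in_itv /= lee_fin modulus_ge0 leey.
- by rewrite in_itv /= Lnorm_ge0 leey.
by rewrite poweR_Lnorm// gt_eqF.
Qed.

End real_classes.

(** * Approximation by simple functions *)

Section simple_density.
Context d (T : measurableType d) (R : realType).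
Variables (mu : {measure set T -> \bar R}) (K : scalarField R).
Variables (p : R) (p1 : 1 <= p).
Hypothesis mu_fin : (mu setT < +oo)%E.
Implicit Types (u v g : T -> R).

Local Notation LK := (Lp mu K p1).
Local Notation ofR := (@of_real R K).

Let p1' : (1 <= p%:E)%E. Proof. by rewrite lee_fin. Qed.

Lemma Lfun_const (r : R) : cst r \in Lfun mu p%:E.
Proof.
have -> : cst r = r *: cst 1 :> (T -> R).
  by apply/funext => x; exact/esym/mulr1.
rewrite rpredZ//.
apply/andP; rewrite !inE /=; split; first exact: measurable_cst.
rewrite /finite_norm (_ : EFin \o cst 1 = cst 1%E)// Lnorm_cst1.
exact: poweR_lty.
Qed.

Lemma Lfun_bounded u (M : R) : measurable_fun setT u ->
  (\forall x \ae mu, `|u x| <= M) -> u \in Lfun mu p%:E.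
Proof. by move=> mu_u; apply: Lfun_dominated (Lfun_const M). Qed.

Lemma Lfun_indic (A : set T) : measurable A -> \1_A \in Lfun mu p%:E.
Proof.
move=> mA; apply: (@Lfun_bounded _ 1); first exact: measurable_indic.
by apply/nearW => x; rewrite indicE; case: (x \in A); rewrite ?normr1 ?normr0.
Qed.

(** Linearity leads from indicators to simple functions, dominated convergence to nonnegative
    functions, and the splitting into positive and negative parts to all of them. [C] will be the
    closure of the polynomials. *)
Lemma Lp_real_simple_approx (C : set LK) : closed C ->
  (forall r F G, C F -> C G -> C (ofR r *: F + G)) -> C 0 ->
  (forall A, measurable A -> C (Lp_real mu K p1 \1_A)) ->
  forall u, u \in Lfun mu p%:E -> C (Lp_real mu K p1 u).
Proof.
move=> clC linC C0 C1.
have Clim (u_ : nat -> T -> R) u g : (forall k, measurable_fun setT (u_ k)) ->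
    measurable_fun setT u -> g \in Lfun mu p%:E ->
    (forall k x, `|u_ k x| <= g x) ->
    (forall x, u_ k x @[k --> \oo] --> u x) ->
    (forall k, C (Lp_real mu K p1 (u_ k))) -> C (Lp_real mu K p1 u).
  move=> mu_ mu_u gL ug uu Cu.
  have : Lp_real mu K p1 (u_ k) @[k --> \oo] --> Lp_real mu K p1 u.
    by apply: (Lp_real_dominated mu_ mu_u gL) => [k|]; exact: nearW.
  by apply: (closed_cvg C clC); exact: nearW.
have Csimple (h : {nnsfun T >-> R}) : C (Lp_real mu K p1 h).
  (* Integrability is carried through the induction because [Lp_real] is additive only on integrable
     functions. *)
  suff [] : (h : T -> R) \in Lfun mu p%:E /\ C (Lp_real mu K p1 h) by [].
  have -> : h =
      \sum_(y <- fset_set (range h)) y *: \1_(h @^-1` [set y]) :> (T -> R).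
    by apply/funext => x; rewrite fimfunE fsbig_finite//= fct_sumE.
  elim/big_rec: _ => [|i v _ [vL Cv]].
    by split; [exact: (Lfun_const 0)|rewrite Lp_real0].
  have mi : measurable (h @^-1` [set i]) by [].
  split; last first.
    by rewrite Lp_real_lin//; [apply: linC => //; exact: C1|exact: Lfun_indic].
  by rewrite rpredD// rpredZ//; exact: Lfun_indic.
have Cnonneg u : u \in Lfun mu p%:E -> (forall x, 0 <= u x) ->
  C (Lp_real mu K p1 u).
  move=> uL u0; have mu_u : measurable_fun setT u.
    by move: uL => /andP[]; rewrite inE.
  have mEu : measurable_fun setT (EFin \o u) by exact/measurable_EFinP.
  apply: (Clim (nnsfun_approx measurableT mEu) u u) => //.
  - move=> k x; rewrite ger0_norm// -lee_fin nnsfun_approxE.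
    exact: (@le_approx _ _ _ setT (EFin \o u) k x (fun x _ => u0 x) I).
  - move=> x.
    have u0' y : setT y -> (0 <= (EFin \o u) y)%E by move=> _; exact: u0.
    exact: fine_cvg (cvg_nnsfun_approx measurableT mEu u0' (x := x) I).
move=> u uL; have mu_u : measurable_fun setT u.
  by move: uL => /andP[]; rewrite inE.
have absuL : (fun x => `|u x|) \in Lfun mu p%:E.
  move: uL => /andP[_]; rewrite inE /= /finite_norm -Lnorm_abse => uoo.
  by apply/andP; rewrite !inE; split => //=; exact: measurableT_comp.
have uposL : u^\+ \in Lfun mu p%:E.
  apply: (Lfun_dominated p1 (measurable_funrpos mu_u) absuL).
  by apply/nearW => x; rewrite ger0_norm// /funrpos ge_max normr_ge0 ler_norm.
have unegL : u^\- \in Lfun mu p%:E.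
  apply: (Lfun_dominated p1 (measurable_funrneg mu_u) absuL).
  by apply/nearW => x; rewrite ger0_norm//
    /funrneg ge_max normr_ge0 -normrN ler_norm.
have -> : u = -1 *: u^\- + u^\+.
  by rewrite scaleN1r addrC funrposBneg.
by rewrite Lp_real_lin//; apply: linC; apply: Cnonneg.
Qed.

End simple_density.

(** * Density of polynomials *)

Section smoothstep.
Variable R : realType.
Implicit Types (q : {poly R}) (x y : R).

(** The cubic 3 y^2 - 2 y^3 maps [0, 1] to itself and fixes 0, 1/2 and 1. Its iterates drive [0,
    1/2[ to 0 and ]1/2, 1] to 1, and they keep polynomials polynomial. *)
Definition smoothstep q : {poly R} := 3 *: q ^+ 2 - 2 *: q ^+ 3.

Let h y : R := 3 * y ^+ 2 - 2 * y ^+ 3.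

Lemma horner_smoothstep k q x :
  (iter k smoothstep q).[x] = iter k h q.[x].
Proof.
elim: k => //= k <-.
by rewrite /smoothstep /h hornerD hornerN !hornerZ !horner_exp.
Qed.

Let h01 y : 0 <= y <= 1 -> 0 <= h y <= 1.
Proof.
move=> /andP[y0 y1]; apply/andP; split.
  rewrite (_ : h y = y ^+ 2 * (3 - 2 * y)); last by rewrite /h; ring.
  by rewrite mulr_ge0 ?exprn_ge0//; lra.
rewrite -subr_ge0 (_ : 1 - h y = (1 - y) ^+ 2 * (1 + 2 * y));
  last by rewrite /h; ring.
by rewrite mulr_ge0 ?exprn_ge0//; lra.
Qed.

Let iter_h0 y : 0 <= y -> y < 1 / 2 -> iter k h y @[k --> \oo] --> (0 : R).
Proof.
(* One step multiplies z by z (3 - 2 z), which increases up to z = 3/4. Since the iterates never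
   exceed y < 1/2, this factor is at most r < 1 and the decay is geometric. *)
move=> y0 y1; pose r := y * (3 - 2 * y).
have r0 : 0 <= r by rewrite /r; nra.
have r1 : r < 1 by rewrite /r; nra.
have yk k : 0 <= iter k h y <= y * r ^+ k /\ iter k h y <= y.
  elim: k => [|k [/andP[z0 zr] zy]] /=; first by rewrite expr0 mulr1 y0 lexx.
  set z := iter k h y in z0 zr zy *.
  have hz : h z <= r * z.
    rewrite (_ : h z = z * (3 - 2 * z) * z); last by rewrite /h; ring.
    rewrite ler_wpM2r// /r -subr_ge0.
    rewrite (_ : _ - _ = (y - z) * (3 - 2 * (y + z))); last by ring.
    by rewrite mulr_ge0//; lra.
  have /andP[hz0 _] : 0 <= h z <= 1 by apply: h01; rewrite z0 /=; lra.
  split; last by rewrite (le_trans hz)//; nra.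
  rewrite hz0 (le_trans hz)// exprS mulrCA ler_wpM2l//.
apply: (@squeeze_cvgr _ _ _ _ (cst 0) (fun k => y * r ^+ k)).
- by apply: nearW => k; have [] := yk k.
- exact: cvg_cst.
- by apply: cvg_geometric; rewrite ger0_norm.
Qed.

Let iter_h1 y : y <= 1 -> 1 / 2 < y -> iter k h y @[k --> \oo] --> (1 : R).
Proof.
(* The symmetry h (1 - y) = 1 - h y exchanges the two basins. *)
move=> y0 y1; have -> : (fun k => iter k h y) = (fun k => 1 - iter k h (1 - y)).
  apply/funext => k; elim: k => /= [|k ->]; first by rewrite opprB addrC subrK.
  by rewrite /h; ring.
rewrite -[X in _ --> X]subr0; apply: cvgB; first exact: cvg_cst.
by apply: iter_h0; lra.
Qed.

Lemma smoothstep01 k q x : 0 <= q.[x] <= 1 ->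
  0 <= (iter k smoothstep q).[x] <= 1.
Proof.
by move=> q01; rewrite horner_smoothstep; elim: k => //= k; exact: h01.
Qed.

(** The point c is excluded because an affine q crosses the repelling fixed value 1/2 there; a
    single point is negligible in Lp. *)
Lemma smoothstep_indic q (c : R) x :
  0 <= q.[x] <= 1 -> (x < c -> 1 / 2 < q.[x]) -> (c < x -> q.[x] < 1 / 2) ->
  x != c -> (iter k smoothstep q).[x] @[k --> \oo] --> (\1_`]-oo, c[ x : R).
Proof.
move=> /andP[q0 q1] qc cq xc; under eq_cvg do rewrite horner_smoothstep.
rewrite indicE; move: xc; rewrite neq_lt => /orP[xc|cx].
  by rewrite mem_set /= ?in_itv//=; apply: iter_h1 => //; exact: qc.
rewrite memNset /= ?in_itv//=; first by apply: iter_h0 => //; exact: cq.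
by apply/negP; rewrite -leNgt ltW.
Qed.

End smoothstep.

(** * Power series and polynomials on the interval *)

Section interval.
Variables (R : realType) (K : scalarField R) (p : R) (p1 : 1 <= p).
Variables (a b : R) (ab : a < b).
Implicit Types (s t : R^nat) (x y M : R) (q : {poly R}).

Local Notation mu := (lebesgue_oo a b).
Local Notation LK := (Lp_interval K p1 a b).
Local Notation ofR := (@of_real R K).

Lemma lebesgue_oo_fin : (mu setT < +oo)%E.
Proof.
rewrite /lebesgue_oo /= /mrestr setTI lebesgue_measure_itv /= lte_fin ab.
exact: ltry.
Qed.

Lemma ae_lebesgue_oo (Q : measurableTypeR R -> Prop) :
  {in `]a, b[, forall x, Q x} -> \forall x \ae mu, Q x.
Proof.
move=> Qab; have := ae_in_oo a b.
by apply: (@filterS _ _ (ae_filter_ringOfSetsType mu)) => x; exact: Qab.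
Qed.

Lemma ae_neq (c : R) : \forall x \ae mu, x != c.
Proof.
exists [set c]; split; first exact: measurable_set1.
  apply/eqP; rewrite -measure_le0; rewrite /lebesgue_oo /= /mrestr.
  rewrite -(lebesgue_measure_set1 c); apply: le_measure => //; rewrite inE.
    exact: measurableI.
  exact: measurable_set1.
by move=> x /= /negP; rewrite negbK => /eqP.
Qed.

Definition exp_fun s : R -> R := fun x => expseries s (x - a).

Lemma continuous_exp_fun M s : exp_bounded M s -> continuous (exp_fun s).
Proof.
move=> Ms x; apply: (@continuous_comp _ _ _ (fun y => y - a) (expseries s)).
  by apply: continuousB; [exact: cvg_id|exact: cvg_cst].
exact: continuous_expseries Ms _.
Qed.

Lemma measurable_exp_fun M s : exp_bounded M s ->
  measurable_fun setT (exp_fun s : measurableTypeR R -> R).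
Proof.
by move=> Ms; apply: continuous_measurable_fun; exact: continuous_exp_fun Ms.
Qed.

Lemma exp_fun_tail M s J x : exp_bounded M s ->
  (forall i, (i < J)%N -> s i = 0) -> x \in `[a, b] ->
  `|exp_fun s x| <= M * exp_tail (2 * (b - a)) J.
Proof.
move=> Ms sJ /[!in_itv] /andP[ax xb]; apply: expseries_tail => //.
by rewrite ger0_norm ?subr_ge0 ?lerB.
Qed.

Lemma exp_fun_Lfun M s : exp_bounded M s -> exp_fun s \in Lfun mu p%:E.
Proof.
move=> Ms; apply: (Lfun_bounded p1 lebesgue_oo_fin (measurable_exp_fun Ms)).
by apply: ae_lebesgue_oo => x xab; apply: (@exp_fun_tail M s 0%N) => //;
  exact: subset_itv_oo_cc.
Qed.

Definition exp_class s : LK := Lp_real mu K p1 (exp_fun s).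

Lemma exp_classB M N s t : exp_bounded M s -> exp_bounded N t ->
  exp_class (s \- t) = exp_class s - exp_class t.
Proof.
move=> Ms Nt; rewrite /exp_class addrC -scaleN1r.
rewrite (_ : exp_fun _ = -1 *: exp_fun t + exp_fun s); last first.
  apply/funext => x; rewrite scaleN1r addrC /exp_fun.
  exact: expseriesB Ms Nt.
rewrite Lp_real_lin; [|exact: exp_fun_Lfun Nt|exact: exp_fun_Lfun Ms].
by rewrite rmorphN rmorph1.
Qed.

Definition poly_class q : LK := Lp_real mu K p1 (fun x => q.[x - a]).

Lemma poly_Lfun q : (fun x => q.[x - a]) \in Lfun mu p%:E.
Proof.
pose s i := q`_i * i`!%:R.
have [|M Ms] := @eventually0_bounded R s.
  by exists (size q) => i qi; rewrite /s nth_default// mul0r.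
rewrite (_ : (fun x => _) = exp_fun s); first exact: exp_fun_Lfun Ms.
by apply/funext => x; rewrite /exp_fun expseries_poly.
Qed.

Lemma poly_class_eventually0 q :
  exists2 s, eventually0 s & poly_class q = exp_class s.
Proof.
exists (fun i => q`_i * i`!%:R).
  by exists (size q) => i qi; rewrite nth_default// mul0r.
by congr Lp_real; apply/funext => x; rewrite /exp_fun expseries_poly.
Qed.

Let indL (S : set R) : measurable S -> \1_S \in Lfun mu p%:E.
Proof. by move=> mS; exact: (Lfun_indic p1 lebesgue_oo_fin). Qed.

Let A := range poly_class.

Let linA r F G : A F -> A G -> A (ofR r *: F + G).
Proof.
move=> [q _ <-] [q' _ <-]; exists (r *: q + q') => //.
rewrite /poly_class -(Lp_real_lin K p1 r (poly_Lfun q) (poly_Lfun q')).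
by congr Lp_real; apply/funext => x; rewrite hornerD hornerZ.
Qed.

Let linclA r F G : closure A F -> closure A G -> closure A (ofR r *: F + G).
Proof. by apply: closure_linear; exact: linA. Qed.

Let A1 : A (Lp_real mu K p1 \1_setT).
Proof.
by exists 1%:P => //; congr Lp_real; apply/funext => x; rewrite indicT hornerC.
Qed.

(** A decreasing affine q with value 1/2 at c maps ]a, b[ into [0, 1]; its smoothstep iterates are
    polynomials that converge boundedly to the indicator. *)
Let A_lt (c : R) : closure A (Lp_real mu K p1 \1_`]-oo, c[).
Proof.
(* This bounds |x - c| on ]a, b[, also for c outside the interval, so that q differs from 1/2 by at
   most 1/2. *)
pose L := `|c - a| + (b - a).
have L0 : 0 < L by rewrite ltr_wpDl ?subr_gt0.
pose q : {poly R} := (1 / 2)%:P - (2 * L)^-1 *: ('X - (c - a)%:P).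
have qE x : q.[x - a] = 1 / 2 - (x - c) / (2 * L).
  by rewrite !hornerE; ring.
have q01 x : x \in `]a, b[ -> 0 <= q.[x - a] <= 1.
  rewrite in_itv /= => /andP[ax xb].
  have xcL : `|(x - c) / (2 * L)| <= 1 / 2.
    rewrite normrM normfV (gtr0_norm (_ : 0 < 2 * L)) ?mulr_gt0//.
    rewrite ler_pdivrMr ?mulr_gt0// mulrA -mulrA mulrC.
    have : `|x - c| <= `|x - a| + `|a - c|.
      by rewrite -[x - c](subrKA a) ler_normD.
    rewrite (gtr0_norm (_ : 0 < x - a)) ?subr_gt0// (distrC a) /L; lra.
  by move: xcL; rewrite qE ler_norml; lra.
have u_cvg : Lp_real mu K p1 (fun x => (iter k (@smoothstep R) q).[x - a])
    @[k --> \oo] --> Lp_real mu K p1 (\1_`]-oo, c[).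
  apply: (@Lp_real_dominated _ _ _ _ _ _ _ _ _ (cst 1)).
  - by move=> k; have := poly_Lfun (iter k (@smoothstep R) q) => /andP[];
      rewrite inE.
  - by apply: measurable_indic; exact: measurable_itv.
  - exact: (Lfun_const p1 lebesgue_oo_fin).
  - move=> k; apply: ae_lebesgue_oo => x /q01 /(smoothstep01 k) /andP[q0 q1].
    by rewrite ger0_norm.
  have ae1 := ae_neq c.
  have ae2 := ae_in_oo a b.
  apply: (@filterS2 _ _ (ae_filter_ringOfSetsType mu) _ _ _ _ ae1 ae2).
  move=> x xc xab.
  have -> : \1_`]-oo, c[ x = \1_`]-oo, c - a[ (x - a) :> R.
    by rewrite !indicE; congr (nat_of_bool _)%:R; apply/idP/idP;
      rewrite !inE /= !in_itv /= ltrD2r.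
  apply: smoothstep_indic; rewrite ?q01 ?(inj_eq (addIr _))// ltrD2r qE => xc'.
    by rewrite ltrBrDl -ltrBrDr subrr pmulr_llt0 ?invr_gt0 ?mulr_gt0// subr_lt0.
  by rewrite ltrBlDl ltrDr divr_gt0 ?mulr_gt0// subr_gt0.
apply: closure_cvgn u_cvg => k; apply: subset_closure.
by exists (iter k (@smoothstep R) q).
Qed.

(** Indicators of disjoint sets add up, which settles the finite unions [U k]; their indicators are
    bounded by 1 and converge pointwise. *)
Let A_bigcup (F : (set R)^nat) : (forall k, measurable (F k)) ->
  trivIset setT F -> (forall k, closure A (Lp_real mu K p1 \1_(F k))) ->
  closure A (Lp_real mu K p1 \1_(\bigcup_k F k)).
Proof.
move=> mF tF AF; pose U k := \bigcup_(i < k) F i.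
have mU k : measurable (U k) by apply: bigcup_measurable.
have AU k : closure A (Lp_real mu K p1 \1_(U k)).
  elim: k => [|k IH].
    rewrite /U (_ : \bigcup_(i < 0) F i = set0); last first.
      by apply/seteqP; split => // x [].
    have -> : \1_set0 = -1 *: \1_setT + \1_setT :> (R -> R).
      by rewrite scaleN1r addNr; apply/funext => x; rewrite indicE in_set0.
    rewrite Lp_real_lin; [|exact: indL|exact: indL].
    by apply: linclA; exact: subset_closure.
  have UF : U k.+1 = U k `|` F k.
    by rewrite /U !bigcup_mkord big_ord_recr.
  have UF0 : U k `&` F k = set0.
    apply/seteqP; split => // x [[i /= ik Fix Fkx]].
    by have := tF i k I I (ex_intro _ x (conj Fix Fkx)) => ik';
      rewrite ik' ltnn in ik.
  have -> : \1_(U k.+1) = 1 *: \1_(U k) + \1_(F k) :> (R -> R).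
    rewrite scale1r UF; apply/funext => x; rewrite fctE !indicE in_setU.
    case: (boolP (x \in U k)) (boolP (x \in F k)) => [xU|_] [xF|_] //=;
      rewrite ?addr0 ?add0r//.
    suff : set0 x by [].
    by rewrite -UF0; split; exact/set_mem.
  by rewrite Lp_real_lin; [exact: linclA|exact: indL|exact: indL].
have u_cvg : Lp_real mu K p1 (\1_(U k)) @[k --> \oo] -->
    Lp_real mu K p1 (\1_(\bigcup_k F k)).
  apply: (@Lp_real_dominated _ _ _ _ _ _ _ _ _ (cst 1)).
  - by move=> k; apply: measurable_indic; exact: mU.
  - by apply: measurable_indic; exact: bigcupT_measurable.
  - exact: (Lfun_const p1 lebesgue_oo_fin).
  - move=> k; apply: ae_lebesgue_oo => x _.
    by rewrite indicE /= normr_nat lern1 leq_b1.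
  (* At each point the sequence of indicators is eventually constant. *)
  apply: ae_lebesgue_oo => x _; apply: cvg_near_cst.
  have [[n _ Fnx]|nFx] := pselect ((\bigcup_k F k) x).
    exists n.+1 => // k /= nk; rewrite !indicE !mem_set//; first by exists n.
    by exists n.
  apply: nearW => k; rewrite !indicE !memNset// => -[i _ Fix]; apply: nFx.
  by exists i.
exact: closure_cvgn AU u_cvg.
Qed.

(** By approximation with simple functions, indicators suffice. The half-lines ]-oo, c[ are stable
    under intersection and generate the Borel sets, and the sets whose indicator lies in the closure
    form a Dynkin system. *)
Lemma poly_class_dense u : u \in Lfun mu p%:E ->
  closure (range poly_class) (Lp_real mu K p1 u).
Proof.
apply: (Lp_real_simple_approx lebesgue_oo_fin) => //.
- exact: closed_closure.
- apply: subset_closure.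
  by have := linA (-1) A1 A1; rewrite rmorphN rmorph1 scaleN1r addNr.
move=> S mS; have : (@RGenInftyO.G R).-sigma.-measurable S.
  by rewrite -RGenInftyO.measurableE.
move: S {mS}; apply: (@dynkin_induction _ (measurableTypeR R)).
- exact: RGenInftyO.measurableE.
- move=> _ _ [c ->] [d ->]; exists (Num.min c d).
  by apply/seteqP; split => x /=; rewrite !in_itv /= lt_min => /andP.
- exact: subset_closure.
- by move=> _ [c ->]; exact: A_lt.
- move=> S mS PS.
  have -> : \1_(~` S) = -1 *: \1_S + \1_setT :> (R -> R).
    apply/funext => x; rewrite scaleN1r !fctE !indicE in_setC in_setT.
    by case: (x \in S); rewrite ?addNr ?oppr0 ?add0r.
  rewrite Lp_real_lin; [|exact: indL|exact: indL].
  by have := linclA (r := -1) PS (subset_closure A1); rewrite rmorphN rmorph1.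
- by move=> F mF tF; exact: A_bigcup.
Qed.

End interval.

(** * Orbits of exponential power series *)

Section derivatives.
Variables (R : realType) (K : scalarField R) (a b : R).
Implicit Types (s : R^nat) (x M : R).
Local Notation ofR := (@of_real R K).
Local Notation exp_fun := (exp_fun a).

(** The isometry [ofR] carries difference quotients over, and a two-sided limit restricts to
    [[a, b]]. *)
Lemma has_deriv_of_real (f : R -> R) x l : is_derive x 1 f l ->
  has_deriv a b (ofR \o f) x (ofR l).
Proof.
move=> [df fl]; apply/cvgrPdist_lt => e e0.
have me0 := modulus_gt0 e0.
have /cvgrPdist_lt/(_ _ me0)/nbhs_ballP[d /= d0 dP] :
  h^-1 *: ((f \o shift x) (h *: 1) - f x)
    @[h --> 0^'] --> l by rewrite -fl; exact: df.
apply: cvg_within; apply/nbhs_ballP; exists d => //= y xyd yx.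
have : ball 0 d (y - x) by rewrite -ball_normE /= sub0r opprB;
  rewrite -ball_normE in xyd.
move=> /dP; rewrite subr_eq0 => /(_ yx).
rewrite /= [_ *: 1]mulr1 subrK => fe;
  rewrite -fmorphV -rmorphB -rmorphM -rmorphB norm_of_real.
by rewrite -(gtr0_norm e0) normE of_real_lt.
Qed.

Lemma is_derive_exp_fun M s x : exp_bounded M s ->
  is_derive x 1 (exp_fun s) (exp_fun (shift_seq 1 s) x).
Proof.
move=> Ms.
have dxa : is_derive x 1 (fun y => y - a) (1 - 0) by exact: is_deriveB.
have := @is_derive1_comp _ (expseries s) (fun y => y - a) x _ _
  (is_derive_expseries (x - a) Ms) dxa.
by rewrite subr0 mulr1.
Qed.

Lemma has_deriv_exp_fun M s x : exp_bounded M s ->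
  has_deriv a b (ofR \o exp_fun s) x (ofR (exp_fun (shift_seq 1 s) x)).
Proof. by move=> Ms; apply: has_deriv_of_real; exact: is_derive_exp_fun Ms. Qed.

Lemma Ck_deriv_exp_fun k M s : exp_bounded M s ->
  Ck_deriv a b k (ofR \o exp_fun s) (ofR \o exp_fun (shift_seq k s)).
Proof.
move=> Ms; split.
  (* Each derivative replaces s by its shift and doubles the bound, so both must vary in the
     induction. *)
  elim: k M s Ms => [|k IH] M s Ms /=; first by move=> x _; rewrite shift_seq0.
  exists (ofR \o exp_fun (shift_seq 1 s)).
    by move=> x _; exact: has_deriv_exp_fun Ms.
  by have := IH _ _ (exp_bounded_shift 1 Ms); rewrite shift_seqD addn1.
apply: continuous_subspaceT => x.
apply: (@continuous_comp _ _ _ (exp_fun (shift_seq k s)) ofR).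
  exact: (@continuous_exp_fun R a _ _ (exp_bounded_shift k Ms)).
exact: continuous_of_real.
Qed.

(** The derivative is bounded on [a, b], so the mean value theorem makes the function Lipschitz. *)
Lemma abs_continuous_exp_fun M s : exp_bounded M s ->
  abs_continuous a b (ofR \o exp_fun s).
Proof.
move=> Ms e e0.
(* The factor M * 2 bounds the shifted sequence, [exp_tail] at 0 is the full exponential, and 1
   keeps C positive when M = 0. *)
pose C := M * 2 * exp_tail (2 * (b - a)) 0 + 1.
have C0 : 0 < C.
  rewrite ltr_wpDl// mulr_ge0// ?mulr_ge0// ?(exp_bounded_ge0 Ms)//.
  by rewrite /exp_tail /series /= big_geq// subr0 expR_ge0.
have lip u v : a <= u -> u <= v -> v <= b ->
    `|exp_fun s v - exp_fun s u| <= C * (v - u).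
  move=> au uv vb; have [||c cuv ->] :=
    @MVT_segment R (exp_fun s) (exp_fun (shift_seq 1 s)) u v uv.
  - by move=> x _; exact: is_derive_exp_fun Ms.
  - by apply: continuous_subspaceT; exact: continuous_exp_fun Ms.
  rewrite normrM (ger0_norm (_ : 0 <= v - u)) ?subr_ge0// ler_wpM2r ?subr_ge0//.
  have M1 := exp_bounded_shift 1 Ms; rewrite expr1 in M1.
  have cab : c \in `[a, b].
    move: cuv; rewrite !in_itv /= => /andP[uc cv].
    by rewrite (le_trans au uc) (le_trans cv vb).
  by rewrite (le_trans (@exp_fun_tail R a b _ _ 0%N c M1 _ cab))// lerDl.
exists (e / C); first exact: divr_gt0.
move=> m u v uv tuv; rewrite ltr_pdivlMr// mulrC; apply: le_lt_trans.
rewrite mulr_sumr ler_sum// => i _; have [aui uvi vbi] := uv i.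
rewrite -rmorphB /modulus re_of_real im_of_real expr0n addr0 sqrtr_sqr.
exact: lip.
Qed.

End derivatives.

(** * Scalar power series, their orbits and their density *)

Section sobolev_orbits.
Variables (R : realType) (K : scalarField R) (p : R) (p1 : 1 <= p).
Variables (a b : R) (ab : a < b) (n : nat) (n_gt0 : (0 < n)%N) (iota : K).
Hypothesis iotaE : forall z : K, z = iota * of_real K (im z) + of_real K (re z).
Implicit Types (s t : R^nat) (x M : R).

Local Notation mu := (lebesgue_oo a b).
Local Notation LK := (Lp_interval K p1 a b).
Local Notation ofR := (@of_real R K).
Local Notation exp_class := (@exp_class R K p p1 a b).
Local Notation one := (Lp_real mu K p1 (cst 1)).
Local Notation D := (nth_deriv_operator K p1 a b n).

(** This is the series with coefficients s_j + iota t_j in [K], kept as two real sequences so that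
    real power series suffice over both fields. *)
Definition scalar_class s t : LK := iota *: exp_class t + exp_class s.

Lemma has_Lp_deriv_exp_class M s : exp_bounded M s ->
  has_Lp_deriv n (exp_class s) (exp_class (shift_seq n s)).
Proof.
move=> Ms; exists (ofR \o exp_fun a s), (ofR \o exp_fun a (shift_seq n.-1 s)).
have Ms1 := exp_bounded_shift n.-1 Ms.
split.
- exact: (Lp_realE K p1 (exp_fun_Lfun p1 ab Ms)).
- exact: Ck_deriv_exp_fun Ms.
- exact: abs_continuous_exp_fun Ms1.
have := Lp_realE K p1 (exp_fun_Lfun p1 ab (exp_bounded_shift n Ms)).
apply: filterS => x ->.
(* The smooth representative is differentiated n - 1 times, and the last derivative is the almost
   everywhere one; n > 0 gives 1 + (n - 1) = n. *)
have -> : shift_seq n s = shift_seq 1 (shift_seq n.-1 s).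
  by rewrite shift_seqD add1n prednK.
exact: has_deriv_exp_fun Ms1.
Qed.

Lemma has_Lp_deriv_scalar_class M s t : exp_bounded M s -> exp_bounded M t ->
  has_Lp_deriv n (scalar_class s t)
    (scalar_class (shift_seq n s) (shift_seq n t)).
Proof.
by move=> Ms Mt; apply: has_Lp_deriv_lin;
  [exact: has_Lp_deriv_exp_class Mt|exact: has_Lp_deriv_exp_class Ms].
Qed.

Lemma nth_deriv_eq f h : has_Lp_deriv n f h -> nth_deriv n f = h :> LK.
Proof.
move=> fh; apply: (has_Lp_deriv_unique _ fh).
by apply: nth_derivP; exists h.
Qed.

Lemma iter_nth_deriv_scalar_class m M s t : exp_bounded M s ->
  exp_bounded M t ->
  iter m (op_fun D) (scalar_class s t) =
  scalar_class (shift_seq (m * n) s) (shift_seq (m * n) t).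
Proof.
move=> Ms Mt; elim: m => [|m IH]; first by rewrite !shift_seq0.
rewrite iterS IH /=.
have H := has_Lp_deriv_scalar_class (exp_bounded_shift (m * n) Ms)
  (exp_bounded_shift (m * n) Mt).
by rewrite (nth_deriv_eq H) !shift_seqD mulSn.
Qed.

Lemma power_dom_scalar_class m M s t : exp_bounded M s -> exp_bounded M t ->
  power_dom D m (scalar_class s t).
Proof.
move=> Ms Mt; elim: m => //= m IH; split => //.
rewrite (iter_nth_deriv_scalar_class m Ms Mt).
have H := has_Lp_deriv_scalar_class (exp_bounded_shift (m * n) Ms)
  (exp_bounded_shift (m * n) Mt).
by eexists; exact: H.
Qed.

(** On ]a, b[ the function is bounded by the constant [B], whose class is [B] times [one]. *)
Lemma norm_exp_class M J s : exp_bounded M s ->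
  (forall i, (i < J)%N -> s i = 0) ->
  `|exp_class s| <= ofR (M * exp_tail (2 * (b - a)) J) * `|one|.
Proof.
move=> Ms sJ; set B := M * _.
have L1 := Lfun_const p1 (lebesgue_oo_fin ab) 1.
have LB := Lfun_const p1 (lebesgue_oo_fin ab) B.
have -> : ofR B * `|one| = `|Lp_real mu K p1 (cst B)|.
  have -> : cst B = B *: cst 1 :> (R -> R).
    by apply/funext => x; exact/esym/mulr1.
  rewrite Lp_realZ// normrZ norm_of_real ger0_norm//
    mulr_ge0 ?(exp_bounded_ge0 Ms)//.
  by rewrite exp_tail_ge0// mulr_ge0// subr_ge0 ltW.
apply: le_norm_Lp_real => //; first exact: exp_fun_Lfun Ms.
by apply: ae_lebesgue_oo => x /subset_itv_oo_cc xab; exact: exp_fun_tail.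
Qed.

Lemma norm_scalar_class : exists2 c : R, 0 <= c & forall M J s t,
  exp_bounded M s -> exp_bounded M t ->
  (forall i, (i < J)%N -> s i = 0) -> (forall i, (i < J)%N -> t i = 0) ->
  `|scalar_class s t| <= ofR (M * exp_tail (2 * (b - a)) J * c).
Proof.
(* The norm of [one] is an element of [K]; its modulus turns it into a real constant. The summands
   |iota| and 1 account for the two components. *)
exists (modulus (`|one| * (`|iota| + 1))); first exact: modulus_ge0.
move=> M J s t Ms Mt sJ tJ.
rewrite rmorphM -normE [X in _ * X]ger0_norm ?mulr_ge0 ?addr_ge0//.
rewrite mulrA mulrDr mulr1 (le_trans (ler_normD _ _))// lerD//.
  by rewrite normrZ mulrC ler_wpM2r//; exact: norm_exp_class.
exact: norm_exp_class.
Qed.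

(** The index J is uniform in s and t: sequences under a common bound that agree far enough give
    close classes. *)
Lemma scalar_class_tail M e : 0 <= M -> 0 < e ->
  \forall J \near \oo, forall s t,
  exp_bounded M s -> exp_bounded M t ->
  (forall i, (i < J)%N -> s i = 0) -> (forall i, (i < J)%N -> t i = 0) ->
  `|scalar_class s t| < ofR e.
Proof.
move=> M0 e0; have [c c0 cP] := norm_scalar_class.
have : M * exp_tail (2 * (b - a)) J * c @[J --> \oo] --> M * 0 * c.
  by apply: cvgMr_tmp; apply: cvgMl_tmp; exact: exp_tail_cvg0.
rewrite mulr0 mul0r => /cvgr_lt/(_ _ e0);
  apply: filterS => J Je s t Ms Mt sJ tJ.
by rewrite (le_lt_trans (cP _ _ _ _ Ms Mt sJ tJ))// of_real_lt.
Qed.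

Lemma scalar_class_small e : 0 < e -> exists2 d : R, 0 < d & forall s t,
  exp_bounded d s -> exp_bounded d t -> `|scalar_class s t| < ofR e.
Proof.
move=> e0; have [c c0 cP] := norm_scalar_class.
pose C := exp_tail (2 * (b - a)) 0 * c.
have C0 : 0 < C + 1.
  by rewrite ltr_wpDl// mulr_ge0// exp_tail_ge0// mulr_ge0// subr_ge0 ltW.
exists (e / (C + 1)) => [|s t ds dt]; first exact: divr_gt0.
rewrite (le_lt_trans (@cP _ 0%N _ _ ds dt _ _))// of_real_lt -mulrA -/C.
by rewrite mulrAC ltr_pdivrMr// ltr_pM2l// ltrDl.
Qed.

Lemma scalar_classB M N M' N' s t s' t' : exp_bounded M s -> exp_bounded N t ->
  exp_bounded M' s' -> exp_bounded N' t' ->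
  scalar_class s t - scalar_class s' t' = scalar_class (s \- s') (t \- t').
Proof.
move=> Ms Nt Ms' Nt'; rewrite /scalar_class.
rewrite (exp_classB K p1 ab Ms Ms') (exp_classB K p1 ab Nt Nt').
by rewrite scalerBr opprD addrACA.
Qed.

(** The real and imaginary parts of f are dominated by its modulus, hence p-integrable, and each is
    approximated by polynomials separately. *)
Lemma scalar_class_dense f : closure
  [set scalar_class s t | s in @eventually0 R & t in @eventually0 R] f.
Proof.
pose u x := re (Lp_repr f x); pose v x := im (Lp_repr f x).
have [mf foo] := Lp_reprP f.
have modL : (fun x => modulus (Lp_repr f x)) \in Lfun mu p%:E.
  by apply/andP; rewrite !inE; split => //; exact: measurable_modulus.
have uL : u \in Lfun mu p%:E.
  apply: (Lfun_dominated p1 mf.1 modL); apply: ae_lebesgue_oo => x _.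
  exact: re_le_modulus.
have vL : v \in Lfun mu p%:E.
  apply: (Lfun_dominated p1 mf.2 modL); apply: ae_lebesgue_oo => x _.
  exact: im_le_modulus.
have -> : f = iota *: Lp_real mu K p1 v + Lp_real mu K p1 u.
  apply: Lp_eq.
  apply: filterS3 (Lp_linE iota (Lp_real mu K p1 v) (Lp_real mu K p1 u))
    (Lp_realE K p1 uL) (Lp_realE K p1 vL) => x -> -> ->.
  exact: iotaE.
have dense1 w : w \in Lfun mu p%:E ->
    closure [set exp_class s | s in @eventually0 R] (Lp_real mu K p1 w).
  move=> wL; apply: closureS (poly_class_dense ab wL) => _ [q _ <-].
  by have [s s0 ->] := poly_class_eventually0 K p1 a b q; exists s.
apply: closureS (closure_scaleD (dense1 _ vL) (dense1 _ uL)).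
by move=> _ [_ [t t0 <-] [_ [s s0 <-] <-]]; exists s => //; exists t.
Qed.

(** Otherwise the continuous functions 1 and 0 would agree at the midpoint of ]a, b[. *)
Lemma Lp_real_one_neq0 : one != 0.
Proof.
apply/eqP => one0.
have L1 := Lfun_const p1 (lebesgue_oo_fin ab) 1.
have L0 := Lfun_const p1 (lebesgue_oo_fin ab) 0.
have r1 := Lp_realE K p1 L1; have r0 := Lp_realE K p1 L0.
have E : one = Lp_real mu K p1 (cst 0) by rewrite one0 Lp_real0.
rewrite E in r1.
have mab : (a + b) / 2 \in `]a, b[ by rewrite in_itv /= !midf_lt.
have /eqP : (cst 1 : R -> K) ((a + b) / 2) = (cst 0 : R -> K) ((a + b) / 2).
  apply: (ae_continuous_eq mab); [exact: cvg_cst|exact: cvg_cst|].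
  apply: (@filterS2 _ _ (ae_filter_ringOfSetsType mu) _ _ _ _ r1 r0).
  move=> x -> /eqP.
  by rewrite /= rmorph1 rmorph0 => /eqP.
by rewrite /= oner_eq0.
Qed.

End sobolev_orbits.

(** * Periodic points and hypercyclic vectors *)

Section hypercyclic_sequence.
Variables (R : realType) (n : nat).
Implicit Types (g : rat * rat -> rat) (r : seq (rat * rat)).

(** The 2-adic valuation takes every value infinitely often, so every word recurs; a number that
    codes no word gives the empty one. *)
Definition word k : seq (rat * rat) := odflt [::] (choice.unpickle (logn 2 k)).

(** With [g] being [fst] or [snd], one word of pairs feeds both coordinate sequences, so that the
    two are displayed simultaneously. *)
Definition coef g r i : R := ratr (g (nth (0, 0) r i)).

(* The truncation bounds the entry of index j by j, and it leaves a given word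
   intact in all but finitely many of its occurrences. *)
Definition blocks g : R^nat := fun j =>
  let k := trunc_log 2 (j %/ n) in
  let c := coef g (word k) (j - n * 2 ^ k) in
  if `|c| <= j%:R then c else 0.

Lemma blocks_le g j : `|blocks g j| <= j%:R.
Proof. by rewrite /blocks; case: ifPn => //; rewrite normr0. Qed.

Lemma natr_le_exp2 j : j%:R <= 2 ^+ j :> R.
Proof. by rewrite -natrX ler_nat ltnW// ltn_expl. Qed.

Lemma blocks_bounded g : exp_bounded 1 (blocks g).
Proof. by move=> j; rewrite mul1r (le_trans (blocks_le g j)) ?natr_le_exp2. Qed.

(** The quotient of i + 2^k n by n lies in [2^k, 2^(k+1)[, so the index falls in block k at offset
    i; being at least 2^k, it leaves the entry untruncated. *)
Lemma blocks_eq g k i : (0 < n)%N -> (i < 2 ^ k * n)%N ->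
  `|coef g (word k) i| <= (2 ^ k)%:R ->
  shift_seq (2 ^ k * n) (blocks g) i = coef g (word k) i.
Proof.
move=> n_gt0 ik ck; have kE : trunc_log 2 ((i + 2 ^ k * n) %/ n) = k.
  apply: trunc_log_eq => //; rewrite addnC divnMDl//
    leq_addr /= expnS mul2n -addnn ltn_add2l.
  by rewrite ltn_divLR.
rewrite /shift_seq /blocks kE mulnC addnK ifT// (le_trans ck)// ler_nat.
by rewrite (leq_trans _ (leq_addl _ _))// leq_pmull.
Qed.

(** An odd factor does not change the 2-adic valuation, and 2 k0 + 1 makes the number as large as
    required. *)
Lemma word_infinitely_often r k0 : exists2 k, (k0 <= k)%N & word k = r.
Proof.
exists (2 ^ choice.pickle r * (2 * k0).+1)%N.
  rewrite (@leq_trans (2 * k0).+1)//; first by lia.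
  by rewrite leq_pmull// expn_gt0.
rewrite /word lognM ?expn_gt0// lognX logn_prime// eqxx muln1.
rewrite (_ : logn 2 _ = 0)%N ?addn0 ?choice.pickleK//.
by rewrite lognE /= dvdn2 /= oddM.
Qed.

Lemma coef_eventually0 g r : g (0, 0) = 0 -> eventually0 (coef g r).
Proof.
move=> g0; exists (size r) => i ri.
by rewrite /coef nth_default// g0 rmorph0.
Qed.

Lemma rational_word (s t : R^nat) (d : R) : eventually0 s -> eventually0 t ->
  0 < d ->
  exists r, exp_bounded d (s \- coef fst r) /\ exp_bounded d (t \- coef snd r).
Proof.
move=> [N sN] [N' tN'] d0.
have /choice[rho rhoP] (x : R) : exists q : rat, `|x - ratr q| < d.
  have [y [xy [q _ qy]]] :=
    @dense_rat R (ball x d) (ex_intro _ x (ballxx x d0)) (ball_open x d).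
  by exists q; move: xy; rewrite -qy -ball_normE.
have dle i : d <= d * 2 ^+ i by rewrite ler_peMr ?(ltW d0)// exprn_ege1// ler1n.
(* Both sequences vanish from [maxn N N'] on, as do the default entries past the end of the word. *)
exists (mkseq (fun i => (rho (s i), rho (t i))) (maxn N N')).
split=> i /=; rewrite /coef.
all: have [iN|Ni] := ltnP i (maxn N N');
  [by rewrite nth_mkseq//= (le_trans _ (dle i))// ltW|].
all: rewrite nth_default ?size_mkseq//= rmorph0 subr0.
  by rewrite sN ?normr0 ?(le_trans (ltW d0))// (leq_trans (leq_maxl _ _) Ni).
by rewrite tN' ?normr0 ?(le_trans (ltW d0))// (leq_trans (leq_maxr _ _) Ni).
Qed.

End hypercyclic_sequence.

(** * Chaos of the derivative operator *)

Section chaos.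
Variables (R : realType) (K : scalarField R) (p : R) (p1 : 1 <= p).
Variables (a b : R) (ab : a < b) (n : nat) (n_gt0 : (0 < n)%N) (iota : K).
Hypothesis iotaE : forall z : K, z = iota * of_real K (im z) + of_real K (re z).
Implicit Types (s t : R^nat) (x M : R).

Local Notation mu := (lebesgue_oo a b).
Local Notation LK := (Lp_interval K p1 a b).
Local Notation ofR := (@of_real R K).
Local Notation D := (nth_deriv_operator K p1 a b n).
Local Notation scalar_class := (scalar_class p1 a b iota).

Lemma closure_scalarP (V : normedModType K) (A : set V) (f : V) :
  (forall e : R, 0 < e -> exists2 g, A g & `|f - g| < ofR e) -> closure A f.
Proof.
move=> h; apply/closure_normP => e e0.
have me0 := modulus_gt0 e0.
have [g Ag fg] := h _ me0; exists g => //.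
by rewrite -(gtr0_norm e0) normE.
Qed.

Lemma periodic_pointP N M s t : (0 < N)%N ->
  exp_bounded M s -> exp_bounded M t ->
  shift_seq (N * n) s = s -> shift_seq (N * n) t = t ->
  periodic_point D (scalar_class s t).
Proof.
move=> N0 Ms Mt sN tN; exists N; split => //.
  exact: (power_dom_scalar_class p1 ab n_gt0 iota _ Ms Mt).
by rewrite (iter_nth_deriv_scalar_class p1 ab n_gt0 iota _ Ms Mt) sN tN.
Qed.

Lemma periodic_points_dense : dense [set f | periodic_point D f].
Proof.
apply: dense_closure => f.
apply: closure_trans (scalar_class_dense ab iotaE (f := f)).
move=> _ [s s0 [t t0 <-]]; apply: closure_scalarP => e e0.
have [Ms Mss] := eventually0_bounded s0.
have [Mt Mtt] := eventually0_bounded t0.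
have [Ms0 Mt0] := (exp_bounded_ge0 Mss, exp_bounded_ge0 Mtt).
pose M := Ms + Mt.
have {}Mss : exp_bounded M s by apply: exp_boundedW Mss; rewrite lerDl.
have {}Mtt : exp_bounded M t by apply: exp_boundedW Mtt; rewrite lerDr.
(* The difference of two sequences bounded by M is bounded by M + M. *)
have [|J0 _ J0P] := @scalar_class_tail R K p p1 a b ab iota (M + M) e _ e0.
  by rewrite !addr_ge0.
(* The period is a positive multiple of n, so that the shift by m is a power of the operator. *)
pose m := (J0.+1 * n)%N.
have mJ0 : (J0 <= m)%N by rewrite /m; nia.
pose per (u : R^nat) : R^nat := fun i => u (i %% m)%N.
have per_bounded u : exp_bounded M u -> exp_bounded M (per u).
  move=> Mu i; rewrite (le_trans (Mu _))// ler_wpM2l ?(exp_bounded_ge0 Mu)//.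
  by rewrite ler_weXn2l ?ler1n// leq_mod.
have per_shift u : shift_seq m (per u) = per u.
  by apply/funext => i; rewrite /shift_seq /per modnDr.
have [Mps Mpt] := (per_bounded _ Mss, per_bounded _ Mtt).
exists (scalar_class (per s) (per t)).
  exact: (periodic_pointP (ltn0Sn J0) Mps Mpt (per_shift _) (per_shift _)).
rewrite (scalar_classB p1 ab iota Mss Mtt Mps Mpt).
apply: (J0P m mJ0); [exact: exp_boundedB|exact: exp_boundedB| |].
  by move=> i im; rewrite /per /= modn_small// subrr.
by move=> i im; rewrite /per /= modn_small// subrr.
Qed.

(** Below J the block displays r. From J on, r is exhausted and the entry of the shifted sequence is
    at most i + J <= 2 i <= 2 * 2^i, whence the bound 2 for every k. *)
Lemma blocks_approx (g : rat * rat -> rat) (r : seq (rat * rat)) :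
  g (0, 0) = 0 -> \forall k \near \oo, word k = r ->
    forall J, J = (2 ^ k * n)%N ->
  exp_bounded 2 (coef R g r \- shift_seq J (blocks R n g)) /\
  (forall i, (i < J)%N -> (coef R g r \- shift_seq J (blocks R n g)) i = 0).
Proof.
move=> g0; have [M Mr] := eventually0_bounded (coef_eventually0 R r g0).
have [N rN] := coef_eventually0 R r g0.
have M0 := exp_bounded_ge0 Mr.
(* Once 2^k >= B, no entry of r reaches the truncation threshold. *)
have [B MB] : exists B : nat, M * 2 ^+ N < B%:R.
  by exists (Num.truncn (M * 2 ^+ N)).+1; exact: truncnS_gt.
exists (maxn N B) => // k /=; rewrite geq_max => /andP[Nk Bk] kr J JE.
have k2J : (2 ^ k <= J)%N by rewrite JE leq_pmulr.
have kJ : (k < J)%N by rewrite (leq_trans _ k2J)// ltn_expl.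
have coef_le i : `|coef R g r i| <= (2 ^ k)%:R.
  have [iN|Ni] := ltnP i N; last by rewrite rN// normr0.
  rewrite (le_trans (Mr i))// (@le_trans _ _ B%:R)//.
    rewrite (le_trans _ (ltW MB))// ler_wpM2l// ler_weXn2l ?ler1n//.
    exact: ltnW.
  by rewrite ler_nat (leq_trans Bk)// ltnW// ltn_expl.
have eqJ i : (i < J)%N -> shift_seq J (blocks R n g) i = coef R g r i.
  by move=> iJ; rewrite JE blocks_eq ?kr -?JE.
split=> [i|i iJ]; last by rewrite /= eqJ// subrr.
rewrite /=; have [iJ|Ji] := ltnP i J.
  by rewrite eqJ// subrr normr0 mulr_ge0.
rewrite rN ?(leq_trans Nk)//; last by lia.
rewrite sub0r normrN (le_trans (blocks_le _ _ _ _))//.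
apply: (@le_trans _ _ (2 * i%:R)).
  by rewrite -natrM ler_nat; lia.
by rewrite ler_wpM2l// natr_le_exp2.
Qed.

Lemma hypercyclic_derivative : hypercyclic D.
Proof.
pose s := blocks R n fst; pose t := blocks R n snd.
have [bs bt] : exp_bounded 1 s /\ exp_bounded 1 t.
  by split; exact: blocks_bounded.
have orbit_dense : dense (Defs.orbit D (scalar_class s t)).
  apply: dense_closure => f.
  apply: closure_trans (scalar_class_dense ab iotaE (f := f)).
  move=> _ [u u0 [v v0 <-]]; apply: closure_scalarP => e e0.
  (* One half of e pays for rounding the coordinates to a rational word, the other for the later
     words behind the displayed one. *)
  have e20 : 0 < e / 2 by exact: divr_gt0.
  have [d d0 dP] := @scalar_class_small R K p p1 a b ab iota _ e20.
  have [r [ur vr]] := rational_word u0 v0 d0.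
  have [J0 _ J0P] :=
    @scalar_class_tail R K p p1 a b ab iota 2 _ (ler0n _ _) e20.
  have [k1 _ k1P] := @blocks_approx fst r erefl.
  have [k2 _ k2P] := @blocks_approx snd r erefl.
  have [k] := word_infinitely_often r (maxn J0 (maxn k1 k2)).
  rewrite !geq_max => /and3P[J0k k1k k2k] kr.
  pose J := (2 ^ k * n)%N.
  have J0J : (J0 <= J)%N.
    by rewrite (leq_trans J0k)// (leq_trans (ltnW (ltn_expl k (ltnSn 1))))//
      leq_pmulr.
  have [rs2 rs0] := k1P k k1k kr J erefl.
  have [rt2 rt0] := k2P k k2k kr J erefl.
  exists (scalar_class (shift_seq J s) (shift_seq J t)).
    (* The shift by J = 2^k n is the iterate of order 2^k. *)
    by exists (2 ^ k)%N => //;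
      rewrite (iter_nth_deriv_scalar_class p1 ab n_gt0 iota _ bs bt).
  have [Mu Muu] := eventually0_bounded u0.
  have [Mv Mvv] := eventually0_bounded v0.
  have [M1 Mr1] := eventually0_bounded (@coef_eventually0 R fst r erefl).
  have [M2 Mr2] := eventually0_bounded (@coef_eventually0 R snd r erefl).
  pose q := scalar_class (coef R fst r) (coef R snd r).
  rewrite -(subrK q (scalar_class u v)).
  rewrite -addrA (le_lt_trans (ler_normD _ _))//.
  rewrite [e]splitr rmorphD ltrD//.
    by rewrite (scalar_classB p1 ab iota Muu Mvv Mr1 Mr2); exact: dP.
  rewrite (scalar_classB p1 ab iota Mr1 Mr2 (exp_bounded_shift J bs)
    (exp_bounded_shift J bt)).
  exact: (J0P J J0J).
exists (scalar_class s t); split => //.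
  (* The orbit of 0 is {0}, which has no element closer to the class of 1 than the norm of that
     class. *)
  apply/eqP => st0; move: orbit_dense; rewrite st0 => orbit_dense.
  have D0 m : iter m (op_fun D) 0 = 0.
    by elim: m => //= m ->; apply: nth_deriv_eq; exact: has_Lp_deriv0.
  have : closure [set (0 : LK)] (Lp_real mu K p1 (cst 1)).
    have := dense_closureT (f := Lp_real mu K p1 (cst 1)) orbit_dense.
    by apply: closureS => _ [m _ <-]; rewrite D0.
  move=> /closure_normP/(_ `|Lp_real mu K p1 (cst 1)|).
  by rewrite normr_gt0 Lp_real_one_neq0// => /(_ isT)[_ ->]; rewrite subr0 ltxx.
by move=> m _; exact: (power_dom_scalar_class p1 ab n_gt0 iota _ bs bt).
Qed.

End chaos.

Theorem theorem3p2 (R : realType) (p : R) (p1 : 1 <= p) (a b : R) (ab : a < b)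
    (n : nat) (n_gt0 : (0 < n)%N) :
  chaotic (nth_deriv_operator (real_scalars R) p1 a b n) /\
  chaotic (nth_deriv_operator (complex_scalars R) p1 a b n).
Proof.
have chaoticP (K : scalarField R) : chaotic (nth_deriv_operator K p1 a b n).
  have [iota iotaE] := scalar_coordinates K.
  split; first exact: (hypercyclic_derivative p1 ab n_gt0 iotaE).
  exact: (@periodic_points_dense R K p p1 a b ab n n_gt0 iota iotaE).
by split; exact: chaoticP.
Qed.
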